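(* Let $m$ be a positive integer, let $\mathcal{D}_m$ be the Shi arrangement of type D, and fix $i$ and $j$ with $1\leq i<j\leq m$. Put $T:=q-2m$. Then for all sufficiently large positive integers $q$: (a) $\left|M\big((\mathcal{D}_m^{\{x_i-x_j=0\}})_q\big)\right|$ equals $$(T+3)^{j-i-1}(T+4)^{m-j}\big((T+4)^i-(T+3)^{i-1}\big)-(T+3)^{m-i-1}(T+4)^{i-1}$$ if $q$ is odd, and $$(T+3)^{j-i-1}(T+4)^{i-1}\big((T+4)^{m-j+1}-(T+3)^{m-j}\big)-(T+3)^{m-i-1}(T+4)^{i-1}$$ if $q$ is even; (b) $\left|M\big((\mathcal{D}_m^{\{x_i-x_j=1\}})_q\big)\right|=(T+2)^{m+i-j}(T+3)^{j-i-1}$; (c) $\left|M\big((\mathcal{D}_m^{\{x_i+x_j=0\}})_q\big)\right|$ equals $$(T+2)^{m-j}(T+3)^{j-i}\big((T+4)^{i-1}-(T+3)^{i-2}\big)$$ if $q$ is odd, and $$(T+2)^{m-j+1}(T+3)^{j-i-1}(T+4)^{i-1}$$ if $q$ is even; (d) $\left|M\big((\mathcal{D}_m^{\{x_i+x_j=1\}})_q\big)\right|$ equals $$(T+2)^{i-1}(T+3)^{j-i}(T+4)^{m-j} - (T+2)^{i-1}(T+3)^{m-i-1}$$ if $q$ is odd, and $$(T+2)^{i-1}(T+3)^{j-i-1}\big((T+4)^{m-j+1}-(T+3)^{m-j}\big)- (T+2)^{i-1}(T+3)^{m-i-1}$$ if $q$ is even.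
   Context: For $q\in\mathbb{Z}_{>0}$ put $\mathbb{Z}_q=\mathbb{Z}/q\mathbb{Z}$. A hyperplane $H$ given by an integral equation $a_1x_1+\cdots+a_mx_m=b$ ($a_k,b\in\mathbb{Z}$) defines $H[q]=\{x\in\mathbb{Z}_q^m \mid a_1x_1+\cdots+a_mx_m= b \text{ in } \mathbb{Z}_q\}$. For a finite set $\mathcal{A}$ of such hyperplanes and $H\in\mathcal{A}$, $\mathcal{A}^H$ denotes the restriction of $\mathcal{A}$ to $H$, and the complement of the restriction modulo $q$ is $$M((\mathcal{A}^H)_q)=H[q]\setminus\bigcup_{K\in\mathcal{A},\,K\neq H}K[q],$$ i.e. the set of points of $H[q]\subseteq\mathbb{Z}_q^m$ lying on no other hyperplane of $\mathcal{A}$ modulo $q$. The Shi arrangement of type D is $\mathcal{D}_m=\{\{x_i\pm x_j=0\},\{x_i\pm x_j=1\}\mid 1\leq i<j\leq m\}$. The formulas are evaluated in the rational numbers: in (c), when $i=1$, $(T+3)^{i-2}$ means $1/(T+3)$ (it is multiplied by $(T+3)^{j-i}$ with $j-i\ge1$). ''For all sufficiently large $q$'' means: there is $q_0$ such that the statement holds for every integer $q\ge q_0$. *)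

(* Defs.v *)
From HB Require Import structures.
From mathcomp Require Import all_boot all_order all_algebra.

Set Implicit Arguments.
Unset Strict Implicit.
Unset Printing Implicit Defensive.

Import Order.TTheory GRing.Theory Num.Theory.
Local Open Scope ring_scope.

(* The hyperplane a_1 x_1 + ... + a_m x_m = b is given by the pair (a, b).
   Two pairs are identified only when they are literally equal, not when they
   are proportional, so an arrangement should list one equation for each of its
   hyperplanes. *)
Definition hyperplane (m : nat) : Type := ('rV[int]_m * int)%type.

(* A finite set of hyperplanes; order and repetitions play no role below. *)
Definition arrangement (m : nat) : Type := seq (hyperplane m).

(* Meaningful for q > 1 only, since 'Z_0 and 'Z_1 are both Z/2Z in MathComp. *)
Definition hyperplane_mod (m q : nat) (H : hyperplane m) : {set 'rV['Z_q]_m} :=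
  [set x : 'rV['Z_q]_m | \sum_(k < m) (H.1 0 k)%:~R * x 0 k == H.2%:~R].

Definition restr_compl_mod (m q : nat) (A : arrangement m) (H : hyperplane m) :
    {set 'rV['Z_q]_m} :=
  hyperplane_mod q H :\: \bigcup_(K <- A | K != H :> 'rV[int]_m * int)
                           hyperplane_mod q K.

(* Coordinates are numbered 1, ..., m: the 0-based index k : 'I_m carries
   x_(k+1). *)
Definition unit_row (m i : nat) : 'rV[int]_m := \row_(k < m) (k.+1 == i)%:R.

Definition hyp_sub (m i j : nat) (c : int) : hyperplane m :=
  (unit_row m i - unit_row m j, c).

Definition hyp_add (m i j : nat) (c : int) : hyperplane m :=
  (unit_row m i + unit_row m j, c).

(* In every equation listed, the first nonzero coefficient is 1, so distinct
   equations define distinct hyperplanes. *)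
Definition shiD (m : nat) : arrangement m :=
  flatten [seq [:: hyp_sub m i j 0; hyp_sub m i j 1;
                   hyp_add m i j 0; hyp_add m i j 1]
          | i <- index_iota 1 m.+1, j <- index_iota i.+1 m.+1].

(* Main.v *)
Require Import Defs.
From HB Require Import structures.
From mathcomp Require Import all_boot all_order all_algebra.
From mathcomp Require Import zify ring lra.
From Stdlib Require Import FunctionalExtensionality.

Set Implicit Arguments.
Unset Strict Implicit.
Unset Printing Implicit Defensive.

Import Order.TTheory GRing.Theory Num.Theory.

(** Why the formulas hold.  Identify x with -x in Z_q.  A coordinate x_k then
    has a position |x_k| in {0, ..., h}, where h = floor (q/2), and a sign; the
    sign is chosen to be minus at position 0 and plus at position q/2, so that
    position and sign determine x_k.  Rank the signed labels by
    1 < 2 < ... < m < -m < ... < -2 < -1.  For two coordinates, avoiding the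
    four equations x_a - x_b = 0, 1 and x_a + x_b = 0, 1 means that the
    positions are distinct and that, when they are neighbours, the rank
    increases from left to right ([generic_pairE]).  So a point outside the
    arrangement is a word of length h + 1 in which every run of consecutive
    letters is sorted by rank.  Such a word is the same thing as a free choice,
    for each letter, of the number of empty positions before it
    ([sort_positionK], [sort_position_arranged]), and the words are counted by
    a product over the letters.

    On a hyperplane of the arrangement the coordinates x_i and x_j determine
    each other; they occupy one position or two neighbouring ones, with
    prescribed signs.  Call this a block, and let all positions that do not
    carry one of the other m - 2 letters, those of the block included, be the
    separators.  Only the letters next to the block are constrained by it, but
    since ranks increase along a run, a bound on the rank of the last letter
    before the block is a bound on all letters between the preceding separator
    and the block ([run_end]), and similarly after the block ([run_start]).
    Hence, once the number s of separators before the block is fixed, the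
    letters again choose their gap and sign independently
    ([card_block_configs]), and the number of choices of a letter depends only
    on whether its label is below i, between i and j, or above j
    ([card_slots], [prod_classes]).

    This number of choices is the same for all s except the first and the last
    value, where the block may reach position 0 or position h.  There the block
    has to be discarded if it satisfies a second one of the four equations for
    x_i and x_j, or if its sign is not the one chosen at 0 or q/2; which of
    these happens at h depends on the parity of q.  The discarded words are the
    ones subtracted in the formulas ([card_block_configsE]).  Each of the four
    hyperplanes gives two blocks, one for each sign of x_i
    ([pair_only_sub0], [pair_only_sub1], [pair_only_add0], [pair_only_add1]),
    and adding their two counts gives the theorem.

    Labels are numbered from 0 in the lemmas. *)

(** * Words cut into runs by separators *)

Section Separators.

Variables (L : finType) (r : L -> nat).
Hypothesis r_inj : injective r.

Definition occupied (p : L -> nat) (c : nat) : bool := [exists k, p k == c].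

Definition seps (p : L -> nat) (c : nat) : nat :=
  \sum_(0 <= d < c) ~~ occupied p d.

Definition arranged (N : nat) (p : L -> nat) : Prop :=
  [/\ forall k, p k < N, injective p
    & forall k l, p l = (p k).+1 -> r k < r l].

Definition precedes (g : L -> nat) (l k : L) : bool :=
  (g l < g k) || (g l == g k) && (r l < r k).

(** The inverse of the passage from positions to gaps: sort the letters by gap,
    then by rank, and leave one place for each separator. *)
Definition sort_position (g : L -> nat) (k : L) : nat :=
  g k + #|[set l | precedes g l k]|.

Lemma occupiedP p c : reflect (exists k, p k = c) (occupied p c).
Proof.
by apply: (iffP existsP) => -[k e]; exists k; apply/eqP.
Qed.

Lemma occupied_pos p k : occupied p (p k).
Proof. by apply/occupiedP; exists k. Qed.

Lemma seps0 p : seps p 0 = 0.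
Proof. by rewrite /seps big_geq. Qed.

Lemma sepsS p c : seps p c.+1 = seps p c + ~~ occupied p c.
Proof. by rewrite /seps big_nat_recr. Qed.

Lemma leq_seps p c d : c <= d -> seps p c <= seps p d.
Proof.
elim: d => [|d IH]; first by rewrite leqn0 => /eqP->.
rewrite leq_eqVlt => /orP[/eqP->//|/IH le_cd].
by rewrite sepsS; apply: leq_trans le_cd (leq_addr _ _).
Qed.

Lemma ltn_seps p c d : c < d -> ~~ occupied p c -> seps p c < seps p d.
Proof.
move=> lt_cd free_c; apply: leq_trans (leq_seps p lt_cd).
by rewrite sepsS free_c addn1.
Qed.

Lemma seps_eq_occupied p c d e :
  seps p c = seps p d -> c <= e -> e < d -> occupied p e.
Proof.
move=> eq_cd le_ce lt_ed; case: (boolP (occupied p e)) => // free_e.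
have := ltn_seps lt_ed free_e; have := leq_seps p le_ce; lia.
Qed.

(** Each of the [c] first positions is a separator or carries one letter. *)
Lemma seps_letters p c :
  injective p -> seps p c + #|[set l | p l < c]| = c.
Proof.
move=> p_inj; elim: c => [|c IH].
  by rewrite seps0 (_ : [set _ | _] = set0) ?cards0 //; apply/setP => l; rewrite !inE.
rewrite sepsS; have [/occupiedP[k pk]|free_c] := boolP (occupied p c).
  rewrite (_ : [set l | p l < c.+1] = k |: [set l | p l < c]).
    by rewrite cardsU1 inE pk ltnn /=; lia.
  apply/setP => l; rewrite !inE ltnS leq_eqVlt -pk.
  by rewrite (inj_eq p_inj).
rewrite (_ : [set l | p l < c.+1] = [set l | p l < c]) ?addn1 /=; first by lia.
apply/setP => l; rewrite !inE ltnS leq_eqVlt.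
by case: eqP => // pl; case/negP: free_c; apply/occupiedP; exists l.
Qed.

Lemma arranged_inj N p : arranged N p -> injective p.
Proof. by case. Qed.

Lemma seps_total N p : arranged N p -> seps p N + #|L| = N.
Proof.
case=> pN p_inj _; rewrite -[RHS](seps_letters N p_inj); congr (_ + _).
by rewrite -cardsT; apply: eq_card => l; rewrite !inE pN.
Qed.

(** Inside a run of consecutive letters the ranks increase step by step. *)
Lemma run_increasing N p k l : arranged N p ->
  p k < p l -> seps p (p k) = seps p (p l) -> r k < r l.
Proof.
move=> [_ p_inj step]; move: {-1}(p l - p k).-1 (erefl (p l - p k).-1) => d.
elim: d l => [|d IH] l dE lt_kl eq_kl; first by apply: step; lia.
have /occupiedP[l' pl'] : occupied p (p l).-1.
  by apply: (seps_eq_occupied eq_kl); lia.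
have lt_l' : r l' < r l by apply: step; lia.
apply: ltn_trans lt_l'; apply: IH; rewrite ?pl'; try lia.
have h1 : seps p (p k) <= seps p (p l).-1 by apply: leq_seps; lia.
have h2 : seps p (p l).-1 <= seps p (p l) by apply: leq_seps; lia.
by lia.
Qed.

Lemma precedesP N p : arranged N p ->
  forall l k, precedes (fun k => seps p (p k)) l k = (p l < p k).
Proof.
move=> Np l k; rewrite /precedes.
have imp a b : p a < p b -> (seps p (p a) < seps p (p b)) \/
    seps p (p a) = seps p (p b) /\ r a < r b.
  move=> lt_ab; have := leq_seps p (ltnW lt_ab).
  rewrite leq_eqVlt => /orP[/eqP e|]; last by left.
  by right; split=> //; apply: run_increasing Np _ e.
case: (ltngtP (p l) (p k)) => [/imp|/imp|]; try lia.
by move/(arranged_inj Np)->; lia.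
Qed.

(** The positions can be recovered from the numbers of separators before the
    letters. *)
Lemma sort_positionK N p : arranged N p ->
  sort_position (fun k => seps p (p k)) =1 p.
Proof.
move=> Np k; rewrite /sort_position -[RHS](@seps_letters p (p k)); last by case: Np.
by congr (_ + _); apply: eq_card => l; rewrite !inE (precedesP Np).
Qed.

Lemma sort_position_lt g l k :
  precedes g l k = (sort_position g l < sort_position g k).
Proof.
have imp a b : precedes g a b -> sort_position g a < sort_position g b.
  move=> ab; rewrite /sort_position.
  have le_ab : g a <= g b by move: ab; rewrite /precedes; lia.
  suff : #|[set l | precedes g l a]| < #|[set l | precedes g l b]| by lia.
  apply: proper_card; apply/properP; split.
    by apply/subsetP => c; rewrite !inE; move: ab; rewrite /precedes; lia.
  by exists a; rewrite inE // /precedes; lia.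
apply/idP/idP => [|lt_lk]; first exact: imp.
case: (eqVneq l k) => [e|ne]; first by move: lt_lk; rewrite e ltnn.
have rne : r l != r k by rewrite (inj_eq r_inj).
apply: contraTT lt_lk => nlk; rewrite -leqNgt ltnW //; apply: imp.
by move: nlk; rewrite /precedes; lia.
Qed.

Lemma sort_position_inj g : injective (sort_position g).
Proof.
move=> k l e; apply: r_inj.
have := sort_position_lt g l k; have := sort_position_lt g k l.
by rewrite e ltnn /precedes; lia.
Qed.

Lemma seps_sort_position g k :
  seps (sort_position g) (sort_position g k) = g k.
Proof.
have := seps_letters (sort_position g k) (@sort_position_inj g).
rewrite (_ : [set l | _] = [set l | precedes g l k]).
  by have : sort_position g k = g k + #|[set l | precedes g l k]| by []; lia.
by apply/setP => l; rewrite !inE sort_position_lt.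
Qed.

(** Conversely every choice of gaps is realized, with exactly [S] separators. *)
Lemma sort_position_arranged S g :
  (forall k, g k <= S) -> arranged (S + #|L|) (sort_position g).
Proof.
move=> gS; split=> [k||k l e]; last 2 first.
- exact: sort_position_inj.
- have : precedes g k l by rewrite sort_position_lt e.
  rewrite /precedes => /orP[lt_g|/andP[]//]; move: e.
  rewrite /sort_position => e.
  suff : #|[set l0 | precedes g l0 k]| < #|[set l0 | precedes g l0 l]| by lia.
  apply: proper_card; apply/properP; split.
    by apply/subsetP => c; rewrite !inE /precedes; lia.
  by exists k; rewrite inE /precedes; lia.
rewrite /sort_position; have := gS k.
suff : #|[set l | precedes g l k]| < #|L| by lia.
rewrite -cardsT; apply: proper_card; apply/properP; split; first exact: subsetT.
by exists k; rewrite inE // /precedes; lia.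
Qed.

Lemma seps_onto p s N : s < seps p N ->
  exists c, [/\ c < N, ~~ occupied p c & seps p c = s].
Proof.
elim: N => [|N IH]; first by rewrite seps0.
rewrite sepsS; case: (ltnP s (seps p N)) => [/IH[c [cN fc sc]] _|].
  by exists c; split=> //; lia.
by case: (boolP (occupied p N)) => [_|fN] /=; [lia | exists N; split=> //; lia].
Qed.

Lemma seps_inj p c d :
  ~~ occupied p c -> ~~ occupied p d -> seps p c = seps p d -> c = d.
Proof.
move=> fc fd e; case: (ltngtP c d) => // lt.
  by have := ltn_seps lt fc; lia.
by have := ltn_seps lt fd; lia.
Qed.

(** Since ranks increase along a run, a property inherited by smaller ranks
    holds on the whole run as soon as it holds at its last letter. *)
Lemma run_end N p c (A : pred L) : arranged N p ->
  ~~ occupied p c -> (forall k l, r k < r l -> A l -> A k) ->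
  (forall k, (p k).+1 = c -> A k) <-> (forall k, seps p (p k) = seps p c -> A k).
Proof.
move=> Np fc down; split=> H k e; last first.
  by apply: H; rewrite -e sepsS occupied_pos addn0.
have lt_kc : p k < c.
  rewrite ltnNge; apply/negP; rewrite leq_eqVlt => /orP[/eqP ck|lt].
    by move: fc; rewrite ck occupied_pos.
  by have := ltn_seps lt fc; lia.
have /occupiedP[l pl] : occupied p c.-1 by apply: (seps_eq_occupied e); lia.
have Al : A l by apply: H; lia.
have [e_kl|ne] := eqVneq k l; first by rewrite e_kl.
have lt : p k < p l.
  have := contra_neq (@arranged_inj _ _ Np k l) ne; lia.
apply: down Al; apply: (run_increasing Np lt).
have := leq_seps p (ltnW lt); have : seps p (p l) <= seps p c by apply: leq_seps; lia.
by lia.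
Qed.

(** The mirror image of [run_end].  The second hypothesis says that [d] is the
    beginning of its gap: it holds at position 0 and just after a separator. *)
Lemma run_start N p d (A : pred L) : arranged N p ->
  (forall k, seps p (p k) = seps p d -> d <= p k) ->
  (forall k l, r k < r l -> A k -> A l) ->
  (forall k, p k = d -> A k) <-> (forall k, seps p (p k) = seps p d -> A k).
Proof.
move=> Np after up; split=> H k e; last by apply: H; rewrite e.
have := after k e; rewrite leq_eqVlt => /orP[/eqP dk|lt]; first exact: H.
have /occupiedP[l pl] : occupied p d by apply: (seps_eq_occupied (esym e)).
have Al : A l by apply: H.
by apply: up Al; apply: run_increasing Np _ _; rewrite pl // e.
Qed.

Lemma seps_after p c k : ~~ occupied p c -> c < p k -> seps p c < seps p (p k).
Proof. by move=> fc lt; apply: ltn_seps. Qed.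

Lemma free_neq p c k : ~~ occupied p c -> p k <> c.
Proof. by move=> fc e; move: fc; rewrite -e occupied_pos. Qed.

(** Whether a separator sits at the very first place can be read from the gaps
    alone; the next two lemmas do the same for the last place and for two
    neighbouring separators. *)
Lemma first_position p c : ~~ occupied p c ->
  c = 0 <-> seps p c = 0 /\ forall k, seps p (p k) <> 0.
Proof.
move=> fc; split=> [c0|[s0 H]].
  subst c; split=> [|k e]; first exact: seps0.
  have : 0 < p k by have := @free_neq p 0 k fc; lia.
  by move/(seps_after fc); lia.
case: (posnP c) => // cpos; have /occupiedP[k pk] : occupied p 0.
  by apply: (@seps_eq_occupied p 0 c) => //; rewrite s0 seps0.
by case: (H k); rewrite pk seps0.
Qed.

Lemma last_position N p c : arranged N p -> c < N -> ~~ occupied p c ->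
  c.+1 = N <-> (seps p c).+1 = seps p N /\ forall k, seps p (p k) <> seps p N.
Proof.
move=> Np cN fc; have sc : seps p c.+1 = (seps p c).+1 by rewrite sepsS fc addn1.
split=> [eN|[e H]].
  rewrite -eN; split=> // k; rewrite sc => e.
  have lt : p k < c.
    by have := @free_neq p c k fc; case: Np => /(_ k); lia.
  by have := leq_seps p (ltnW lt); lia.
case: (ltngtP c.+1 N) => // [lt|]; last by lia.
have /occupiedP[k pk] : occupied p c.+1.
  by apply: (@seps_eq_occupied p c.+1 N) => //; rewrite sc.
by case: (H k); rewrite pk sc.
Qed.

Lemma adjacent_separators N p c : arranged N p -> c < N -> ~~ occupied p c ->
  (c.+1 < N /\ ~~ occupied p c.+1) <->
  ((seps p c).+1 < seps p N /\ forall k, seps p (p k) <> (seps p c).+1).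
Proof.
move=> Np cN fc; have sc : seps p c.+1 = (seps p c).+1 by rewrite sepsS fc addn1.
split=> [[c1N fc1]|[lt H]].
  split=> [|k e]; first by have := ltn_seps c1N fc1; lia.
  have ne0 := @free_neq p c k fc; have ne1 := @free_neq p c.+1 k fc1.
  have [lt|lt] : p k < c \/ c.+1 < p k by lia.
    by have := leq_seps p (ltnW lt); lia.
  by have := ltn_seps lt fc1; lia.
have ne : c.+1 <> N by move=> e; move: lt; rewrite -e sc ltnn.
split; first by lia.
by apply/negP => /occupiedP[k pk]; case: (H k); rewrite pk sc.
Qed.

End Separators.

(** * Folding the residues modulo q *)

Section Folding.

Definition fold_pos (q : nat) (x : 'Z_q) : nat := minn x (q - x).
Definition fold_sgn (q : nat) (x : 'Z_q) : bool := 0 < x <= q./2.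
Definition unfold_pos (q c : nat) (s : bool) : 'Z_q := inZp (if s then c else q - c).

(** The pairs that occur as position and sign: the conventions at the two fixed
    points 0 and q/2 of the negation make the pair unique. *)
Definition signed_pos (q c : nat) (s : bool) : bool :=
  [&& c <= q./2, (c == 0) ==> ~~ s & (c.*2 == q) ==> s].

(** The order 0 < 1 < ... < m - 1 < -(m - 1) < ... < -1 < -0 on signed labels. *)
Definition rank (m k : nat) (s : bool) : nat := if s then k else m.*2 - k.

Lemma val_Zq q (x : 'Z_q) : 1 < q -> x < q.
Proof. by move=> q1; rewrite -[X in _ < X](Zp_cast q1) ltn_ord. Qed.

Lemma fold_signed q (x : 'Z_q) : 1 < q -> signed_pos q (fold_pos x) (fold_sgn x).
Proof.
by move=> q1; have := val_Zq x q1; rewrite /signed_pos /fold_pos /fold_sgn; lia.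
Qed.

Lemma unfoldK q c s : 1 < q -> signed_pos q c s ->
  fold_pos (unfold_pos q c s) = c /\ fold_sgn (unfold_pos q c s) = s.
Proof.
move=> q1; rewrite /signed_pos => /and3P[cq c0 cE].
have vE : unfold_pos q c s = (if s then c else q - c) %% q :> nat.
  by rewrite /unfold_pos /= Zp_cast.
rewrite /fold_pos /fold_sgn vE; case: s c0 cE {vE} => c0 cE.
  by rewrite modn_small; lia.
have [->|c1] := posnP c; first by rewrite subn0 modnn; lia.
by rewrite modn_small; lia.
Qed.

Lemma foldK q (x : 'Z_q) : 1 < q -> unfold_pos q (fold_pos x) (fold_sgn x) = x.
Proof.
move=> q1; have xq := val_Zq x q1; apply: val_inj.
rewrite /unfold_pos /= /fold_pos /fold_sgn [X in _ %% X]Zp_cast //.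
have [x0|x1] := posnP x; first by rewrite x0 /= (_ : q - _ = q) ?modnn //; lia.
set a := (if _ then _ else _); have -> : a = x by rewrite /a; case: ifP; lia.
by rewrite modn_small.
Qed.

Lemma eq_fold q (x y : 'Z_q) : 1 < q ->
  fold_pos x = fold_pos y -> fold_sgn x = fold_sgn y -> x = y.
Proof. by move=> q1 e1 e2; rewrite -(foldK x q1) e1 e2 foldK. Qed.

Local Open Scope ring_scope.

Definition generic_pair q (u v : 'Z_q) : bool :=
  [&& u - v != 0, u - v != 1, u + v != 0 & u + v != 1].

Lemma Zq_eqs q (u v : 'Z_q) : (1 < q)%N ->
  [/\ (u - v == 0) = (u == v :> nat)%N,
      (u - v == 1) = ((u == v.+1 :> nat) || (u == 0 :> nat) && (v.+1 == q))%N,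
      (u + v == 0) = ((u + v == 0) || (u + v == q))%N
    & (u + v == 1) = ((u + v == 1) || (u + v == q.+1))%N].
Proof.
move=> q1; have uq := val_Zq u q1; have vq := val_Zq v q1.
have modE (a : nat) : (a < q + q)%N -> (a %% q)%N = (if a < q then a else a - q)%N.
  case: (ltnP a q) => [aq _|qa aqq]; first by rewrite modn_small.
  by rewrite -{1}(subnK qa) modnDr modn_small //; lia.
have vD (a b : 'Z_q) : (a + b : 'Z_q) = ((a + b)%N %% q)%N :> nat.
  by rewrite /= [X in (_ %% X)%N]Zp_cast.
have v1 : (1 : 'Z_q) = 1%N :> nat by rewrite /= [X in (_ %% X)%N]Zp_cast // modn_small.
split.
- by rewrite subr_eq0 -val_eqE.
- rewrite subr_eq -val_eqE [X in _ == X]vD v1 modE; last by lia.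
  by case: ifP => /=; lia.
- by rewrite -val_eqE [X in X == _]vD modE; [case: ifP => /=; lia | lia].
- by rewrite -val_eqE [X in X == _]vD [X in _ == X]v1 modE; [case: ifP => /=; lia | lia].
Qed.

(** For [a < b] the ranks compare according to the sign of the smaller label
    alone, which is what the equations with right-hand side 1 see.  The chosen
    signs at 0 and q/2 make this correct there too: at 0 both signs of the label
    are present, and the minus sign gives the stronger condition on the letter
    at position 1; at q/2 it is the plus sign, for the letter before. *)
Lemma generic_pairE q m a b (u v : 'Z_q) : (1 < q)%N -> (a < b < m)%N ->
  generic_pair u v =
  [&& fold_pos u != fold_pos v,
      (fold_pos v == (fold_pos u).+1) ==>
        (rank m a (fold_sgn u) < rank m b (fold_sgn v))%N
    & (fold_pos u == (fold_pos v).+1) ==>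
        (rank m b (fold_sgn v) < rank m a (fold_sgn u))%N].
Proof.
move=> q1 ab; have uq := val_Zq u q1; have vq := val_Zq v q1.
rewrite /generic_pair; case: (Zq_eqs u v q1) => -> -> -> ->.
have -> : (rank m a (fold_sgn u) < rank m b (fold_sgn v))%N = fold_sgn u.
  by rewrite /rank; case: (fold_sgn u); case: (fold_sgn v); lia.
have -> : (rank m b (fold_sgn v) < rank m a (fold_sgn u))%N = ~~ fold_sgn u.
  by rewrite /rank; case: (fold_sgn u); case: (fold_sgn v); lia.
by rewrite /fold_pos /fold_sgn; lia.
Qed.

End Folding.

(** * Configurations with a tied pair of coordinates *)

(** A block is a pair of values for the coordinates [I] and [J]: for some [c],
    they sit at the positions [c + oi] and [c + oj] with the signs [si] and
    [sj].  At most one of the offsets is nonzero, so the block fills the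
    positions from [c] to [c + w].  The flags [noleft] and [noright] exclude the
    blocks that begin at position 0, resp. end at position q/2 (rounded down). *)
Section Blocks.

Variables (m q : nat) (I J : 'I_m) (oi si oj sj noleft noright : bool).
Hypotheses (ltIJ : I < J) (oij : ~~ (oi && oj)) (q4 : 3 < q) (mq : m <= q./2).

Local Notation N := (q./2).+1.
Local Notation w := (oi + oj).

Definition letters := {k : 'I_m | (k != I) && (k != J)}.
Local Notation L := letters.

Definition label (k : L) : nat := sval k.

Lemma label_lt k : label k < m. Proof. exact: ltn_ord. Qed.

Lemma label_inj : injective label.
Proof. by move=> k l e; apply: val_inj; apply: val_inj. Qed.

Definition nsep : nat := N - #|{: L}|.

(** Whether the letter [k] with sign [b] may stand just before the block, resp.
    (for [post]) just after it: only the coordinates at that end matter. *)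
Definition pre (k : nat) (b : bool) : bool :=
  (~~ oi ==> (rank m k b < rank m I si)) && (~~ oj ==> (rank m k b < rank m J sj)).

Definition post (k : nat) (b : bool) : bool :=
  ((oi || ~~ oj) ==> (rank m I si < rank m k b)) &&
  ((oj || ~~ oi) ==> (rank m J sj < rank m k b)).

(** The gap [s] lies just before the block and the gap [(s + w).+1] just after
    it.  The first two conditions are the sign conventions at position 0 and, for
    even [q], at position q/2: they propagate from the outermost letter to the
    whole outermost run.  The last one keeps the two positions of a block
    together. *)
Definition allowed (s : nat) (k : nat) (g : nat) (b : bool) : bool :=
  [&& (g == 0) ==> ~~ b, (~~ odd q && (g == nsep)) ==> b, (g == s) ==> pre k b,
      (g == (s + w).+1) ==> post k b & (oi || oj) ==> (g != s.+1)].

Definition gap_choice (s : nat) (g : L -> nat) (sg : L -> bool) : Prop :=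
  [/\ s + w < nsep, forall k : L, allowed s (label k) (g k) (sg k),
      noleft -> ~ (s = 0 /\ forall k, g k <> 0)
    & noright -> ~ ((s + w).+1 = nsep /\ forall k, g k <> nsep)].

Definition position_choice (c : nat) (p : L -> nat) (sg : L -> bool) : Prop :=
  [/\ [/\ forall k, p k = 0 -> ~~ sg k,
          forall k, (p k).+1 = N -> ~~ odd q ==> sg k,
          c + w < N /\ ~~ occupied p (c + w)
        & forall k : L, (p k).+1 = c -> pre (label k) (sg k)],
      forall k : L, p k = (c + w).+1 -> post (label k) (sg k),
      noleft -> c <> 0
    & noright -> (c + w).+1 <> N].

Local Notation letter_rank sg := (fun k : L => rank m (label k) (sg k)).

Lemma rank_ltm k l a b : k < m -> l < m -> rank m k a < rank m l b ->
  (~~ a -> ~~ b) /\ (b -> a).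
Proof. by rewrite /rank; case: a; case: b; lia. Qed.

Lemma letter_rank_inj sg : injective (letter_rank sg).
Proof.
move=> k l; rewrite /rank => e; apply: label_inj; move: e.
by have := label_lt k; have := label_lt l; case: (sg k); case: (sg l); lia.
Qed.

Lemma card_letters_le : #|{: L}| <= m.
Proof. by rewrite card_sig -[X in _ <= X](card_ord m) max_card. Qed.

Lemma nsepE : nsep + #|{: L}| = N.
Proof. by rewrite /nsep subnK // (leq_trans card_letters_le) // (leq_trans mq). Qed.

Lemma seps_nsep sg p : arranged (letter_rank sg) N p -> seps p N = nsep.
Proof.
move=> Np; apply/eqP; rewrite -(eqn_add2r #|{: L}|) nsepE; apply/eqP.
exact: seps_total Np.
Qed.

(** All conditions are local, at the ends of runs; since each of them is monotone
    in the rank, they amount to conditions on the gaps of the letters. *)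
Lemma position_choiceP sg p c : arranged (letter_rank sg) N p ->
  ~~ occupied p c -> c < N ->
  position_choice c p sg <-> gap_choice (seps p c) (fun k => seps p (p k)) sg.
Proof.
move=> Np fc cN; have SE := seps_nsep Np.
have sc : seps p c.+1 = (seps p c).+1 by rewrite sepsS fc addn1.
have fN : ~~ occupied p N.
  by apply/negP => /occupiedP[k pk]; case: Np => /(_ k); rewrite pk ltnn.
have left : (forall k, p k = 0 -> ~~ sg k) <->
    (forall k, seps p (p k) = 0 -> ~~ sg k).
  have := @run_start L _ N p 0 (fun k => ~~ sg k) Np; rewrite seps0; apply=> // k l.
  by case/rank_ltm; rewrite ?label_lt.
have right : (forall k, (p k).+1 = N -> ~~ odd q ==> sg k) <->
    (forall k, seps p (p k) = nsep -> ~~ odd q ==> sg k).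
  have := run_end (A := fun k => ~~ odd q ==> sg k) Np fN; rewrite SE; apply=> k l.
  by case/rank_ltm; rewrite ?label_lt // => _ H /implyP H1; apply/implyP => /H1.
have before : (forall k : L, (p k).+1 = c -> pre (label k) (sg k)) <->
    (forall k : L, seps p (p k) = seps p c -> pre (label k) (sg k)).
  apply: (run_end (A := fun k => pre (label k) (sg k)) Np fc) => k l lt.
  by rewrite /pre; lia.
have free_w : (c + w < N /\ ~~ occupied p (c + w)) <->
    (seps p c + w < nsep /\ forall k, (oi || oj) ==> (seps p (p k) != (seps p c).+1)).
  have [w0|w1] : w = 0 \/ w = 1 by lia.
    rewrite w0 !addn0; split=> _; last by split.
    split=> [|k]; last by lia.
    by rewrite -SE; apply: ltn_seps.
  rewrite w1 !addn1 (adjacent_separators Np cN fc) SE.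
  by split=> -[lt H]; split=> // k; have := H k; lia.
have wS : c + w < N /\ ~~ occupied p (c + w) -> seps p (c + w) = seps p c + w.
  have [->|->] : w = 0 \/ w = 1 by lia.
    by rewrite !addn0.
  by rewrite !addn1 sc.
have after : c + w < N /\ ~~ occupied p (c + w) ->
    (forall k : L, p k = (c + w).+1 -> post (label k) (sg k)) <->
    (forall k : L, seps p (p k) = (seps p c + w).+1 -> post (label k) (sg k)).
  move=> fw; have := wS fw; case: fw => cwN fcw swE.
  have <- : seps p (c + w).+1 = (seps p c + w).+1 by rewrite sepsS fcw addn1 swE.
  apply: (run_start (A := fun k => post (label k) (sg k)) Np) => [k|k l lt].
    rewrite sepsS fcw addn1 leqNgt => e; apply/negP; rewrite ltnS => lt.
    by have := leq_seps p lt; lia.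
  by rewrite /post; lia.
have first := first_position fc.
have last : c + w < N /\ ~~ occupied p (c + w) ->
    (c + w).+1 = N <-> (seps p c + w).+1 = nsep /\ forall k, seps p (p k) <> nsep.
  move=> fw; rewrite -(wS fw) -SE; case: fw => cwN fcw.
  exact: (last_position Np cwN fcw).
split=> [[[h1 h2 h3 h4] h5 h6 h7]|[h1 h2 h3 h4]].
  have [h8 h9] := free_w.1 h3; split=> [//|k||].
  - apply/and5P; split; apply/implyP => // h.
    + by apply: left.1 => //; apply/eqP.
    + by case/andP: h => od /eqP e; have /implyP := right.1 h2 k e; apply.
    + by apply: before.1 => //; apply/eqP.
    + by apply: (after h3).1 => //; apply/eqP.
    + by have /implyP := h9 k; apply.
  - by move=> nl [e H]; case: (h6 nl); apply/first.
  - by move=> nr [e H]; case: (h7 nr); apply/(last h3).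
have h3' : c + w < N /\ ~~ occupied p (c + w).
  by apply/free_w; split=> // k; have /and5P[] := h2 k.
split.
- split=> //.
  + by apply/left => k e; have /and5P[/implyP H _ _ _ _] := h2 k; apply: H; apply/eqP.
  + apply/right => k e; apply/implyP => od.
    by have /and5P[_ /implyP H _ _ _] := h2 k; apply: H; rewrite od e /=.
  + by apply/before => k e; have /and5P[_ _ /implyP H _ _] := h2 k; apply: H; apply/eqP.
- by apply/(after h3') => k e; have /and5P[_ _ _ /implyP H _] := h2 k; apply: H; apply/eqP.
- by move=> nl /first[e H]; case: (h3 nl); split.
- by move=> nr /(last h3')[e H]; case: (h4 nr); split.
Qed.

(** The first position of the block is written [fold_pos u - oi] as well as
    [fold_pos v - oj]; the sums avoid truncated subtraction. *)
Definition block_at (u v : 'Z_q) : bool :=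
  [&& fold_sgn u == si, fold_sgn v == sj, fold_pos u + oj == fold_pos v + oi,
      noleft ==> (fold_pos u != oi) & noright ==> (fold_pos u + oj != q./2)].

Definition block_configs : {set 'rV['Z_q]_m} :=
  [set x : 'rV['Z_q]_m | block_at (x ord0 I) (x ord0 J) &&
    [forall a : 'I_m, forall b : 'I_m, (a < b) && ((a, b) != (I, J)) ==>
      generic_pair (x ord0 a) (x ord0 b)]].

Definition choices : {set 'I_nsep.+1 * {ffun L -> 'I_nsep.+1 * bool}} :=
  [set sf : 'I_nsep.+1 * {ffun L -> 'I_nsep.+1 * bool} |
   [&& sf.1 + w < nsep,
       [forall k, allowed sf.1 (label k) (sf.2 k).1 (sf.2 k).2],
       noleft ==> ~~ ((sf.1 == 0 :> nat) && [forall k, (sf.2 k).1 != 0 :> nat])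
     & noright ==>
         ~~ (((sf.1 + w).+1 == nsep) && [forall k, (sf.2 k).1 != nsep :> nat])]].

Lemma choicesP (s : 'I_nsep.+1) (f : {ffun L -> 'I_nsep.+1 * bool}) :
  (s, f) \in choices <-> gap_choice s (fun k => (f k).1) (fun k => (f k).2).
Proof.
rewrite inE /=; split.
  case/and4P=> h1 /forallP h2 /implyP h3 /implyP h4; split=> // [/h3|/h4] /negP h [/eqP e H];
    apply: h; rewrite e /=; apply/forallP => k; apply/eqP; exact: H.
case=> h1 h2 h3 h4; apply/and4P; split=> //; first exact/forallP.
  apply/implyP => /h3 h; apply/negP => /andP[/eqP e /forallP H]; apply: h.
  by split=> // k; apply/eqP.
apply/implyP => /h4 h; apply/negP => /andP[/eqP e /forallP H]; apply: h.
by split=> // k; apply/eqP.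
Qed.

(** The right-hand side of [generic_pairE], which is symmetric in the two
    coordinates and so needs no case distinction on the order of the labels. *)
Definition adjacency (P R : 'I_m -> nat) (a b : 'I_m) : bool :=
  [&& P a != P b, (P b == (P a).+1) ==> (R a < R b)
    & (P a == (P b).+1) ==> (R b < R a)].

Lemma adjacencyC P R a b : adjacency P R a b = adjacency P R b a.
Proof. by rewrite /adjacency eq_sym; congr (_ && _); rewrite andbC. Qed.

(** The two positions of a block of width 1 shield each other: a letter that
    avoids the block can only touch its outer ends, which is why the separate
    conditions for [I] and [J] and the conditions [pre] and [post] agree. *)
Lemma pre_post_intro k b n c :
  (c + oi = n.+1 -> rank m k b < rank m I si) ->
  (c + oj = n.+1 -> rank m k b < rank m J sj) ->
  (n = (c + oi).+1 -> rank m I si < rank m k b) ->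
  (n = (c + oj).+1 -> rank m J sj < rank m k b) ->
  (n.+1 = c -> pre k b) /\ (n = (c + w).+1 -> post k b).
Proof.
move: oij; rewrite /pre /post; set x := rank m k b; set y := rank m I si.
set z := rank m J sj; move: x y z => x y z.
by case: oi; case: oj; rewrite //= ?addn0 ?addn1 => _ h1 h2 h3 h4; split=> e;
  rewrite ?h1 ?h2 ?h3 ?h4.
Qed.

Lemma pre_post_elim k b n c : n <> c -> n <> c + w ->
  (n.+1 = c -> pre k b) -> (n = (c + w).+1 -> post k b) ->
  [/\ n <> c + oi, c + oi = n.+1 -> rank m k b < rank m I si
    & n = (c + oi).+1 -> rank m I si < rank m k b] /\
  [/\ n <> c + oj, c + oj = n.+1 -> rank m k b < rank m J sj
    & n = (c + oj).+1 -> rank m J sj < rank m k b].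
Proof.
move: oij; rewrite /pre /post; set x := rank m k b; set y := rank m I si.
set z := rank m J sj; move: x y z => x y z.
case: oi; case: oj; rewrite //= ?andbT ?addn0 ?addn1 => _ h1 h2 h3 h4.
- by split; split=> // e; (lia || exact: h3).
- by split; split=> // e; (lia || exact: h3).
- by split; split=> // e; [case/andP: (h3 (esym e)) | case/andP: (h4 e)
    | case/andP: (h3 (esym e)) | case/andP: (h4 e)].
Qed.

Definition letter_pos (x : 'rV['Z_q]_m) (k : L) : nat := fold_pos (x ord0 (sval k)).
Definition letter_sgn (x : 'rV['Z_q]_m) (k : L) : bool := fold_sgn (x ord0 (sval k)).
Definition block_pos (x : 'rV['Z_q]_m) : nat := fold_pos (x ord0 I) - oi.

Section Config.

Variables (x : 'rV['Z_q]_m) (c : nat).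

Local Notation P := (fun a : 'I_m => fold_pos (x ord0 a)).
Local Notation R := (fun a : 'I_m => rank m a (fold_sgn (x ord0 a))).

Lemma letterVblock (a : 'I_m) : (exists k : L, sval k = a) \/ (a = I \/ a = J).
Proof.
case: (boolP ((a != I) && (a != J))) => [h|]; first by left; exists (exist _ a h).
by rewrite negb_and !negbK => /orP[]/eqP; right; [left | right].
Qed.

Lemma generic_pairsP :
  [forall a : 'I_m, forall b : 'I_m, (a < b) && ((a, b) != (I, J)) ==>
      generic_pair (x ord0 a) (x ord0 b)] <->
  [/\ forall k l : L, k != l -> adjacency P R (sval k) (sval l),
      forall k : L, adjacency P R (sval k) I
    & forall k : L, adjacency P R (sval k) J].
Proof.
have q1 : 1 < q by lia.
have E (a b : 'I_m) : a < b ->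
    generic_pair (x ord0 a) (x ord0 b) = adjacency P R a b.
  by move=> ab; rewrite (@generic_pairE q m a b) // ab ltn_ord.
split=> [/forallP H|[H1 H2 H3]].
  have adj (a b : 'I_m) : a != b -> (a, b) != (I, J) -> (b, a) != (I, J) ->
      adjacency P R a b.
    move=> ab h1 h2; have /forallP Ha := H a; have /forallP Hb := H b.
    case: (ltngtP a b) => [lt|lt|/val_inj e].
    - by rewrite -E //; apply: (implyP (Ha b)); rewrite lt.
    - by rewrite adjacencyC -E //; apply: (implyP (Hb a)); rewrite lt.
    - by rewrite e eqxx in ab.
  split=> [k l kl|k|k]; have /andP[kI kJ] := valP k;
    by apply: adj; rewrite ?xpair_eqE ?(negPf kI) ?(negPf kJ) ?andbF // -val_eqE.
apply/forallP => a; apply/forallP => b; apply/implyP => /andP[ab nIJ].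
rewrite E //.
have [[k ka]|aIJ] := letterVblock a.
  rewrite -ka; have [[l lb]|[->|->]//] := letterVblock b.
  rewrite -lb; apply: H1; apply: contraTneq ab => kl.
  by rewrite -ka -lb kl ltnn.
have [[l lb]|bIJ] := letterVblock b.
  by rewrite adjacencyC -lb; case: aIJ => ->.
by exfalso; case: aIJ bIJ ab nIJ => -> [] ->; rewrite ?ltnn ?eqxx //; have := ltIJ; lia.
Qed.

Hypotheses (PI : P I = c + oi) (PJ : P J = c + oj).
Hypotheses (sI : fold_sgn (x ord0 I) = si) (sJ : fold_sgn (x ord0 J) = sj).

Local Notation p := (fun k : L => P (sval k)).
Local Notation sg := (fun k : L => fold_sgn (x ord0 (sval k))).

(** The pairs of letters say that the word is sorted along its runs; the pairs
    formed by a letter and one of [I], [J] say that the block is compatible with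
    its neighbours. *)
Lemma block_configsP :
  x \in block_configs <->
  [/\ arranged (letter_rank sg) N p, ~~ occupied p c & position_choice c p sg].
Proof.
have q1 : 1 < q by lia.
have fs a : signed_pos q (P a) (fold_sgn (x ord0 a)) by apply: fold_signed.
have cN : c + w < N by have := fs I; have := fs J; rewrite /signed_pos PI PJ; lia.
have RI : R I = rank m I si by rewrite sI.
have RJ : R J = rank m J sj by rewrite sJ.
rewrite inE /block_at sI sJ PI PJ !eqxx /=.
have -> /= : c + oi + oj == c + oj + oi by lia.
have adjE (a b : 'I_m) : adjacency P R a b <->
    [/\ P a <> P b, P b = (P a).+1 -> R a < R b & P a = (P b).+1 -> R b < R a].
  rewrite /adjacency; split.
    by case/and3P=> /eqP h1 /implyP h2 /implyP h3; split=> // /eqP.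
  by case=> h1 h2 h3; apply/and3P; split; [apply/eqP | apply/implyP=> /eqP..].
split.
  case/andP=> /andP[nl nr] /generic_pairsP[H1 H2 H3].
  have fc : ~~ occupied p c.
    apply/negP => /occupiedP[k pk].
    have /adjE[+ _ _] := H2 k; have /adjE[+ _ _] := H3 k; rewrite PI PJ.
    by clear -pk oij; lia.
  have fcw : ~~ occupied p (c + w).
    apply/negP => /occupiedP[k pk].
    have /adjE[+ _ _] := H2 k; have /adjE[+ _ _] := H3 k; rewrite PI PJ.
    by clear -pk oij; lia.
  have adjL (k l : L) : k != l -> adjacency P R (sval k) (sval l).
    exact: H1.
  split=> //.
  - split=> [k|k l e|k l e].
    + by have /and3P[] := fs (sval k).
    + apply/eqP; apply: contraT => kl.
      by have /adjE[/(_ e)] := adjL k l kl.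
    + have kl : k != l by apply/eqP => kl; move: e; rewrite kl; clear; lia.
      by have /adjE[_ h _] := adjL k l kl; apply: h.
  - split.
    + split=> [k e|k e||k e] //.
      * by have /and3P[_ /implyP h _] := fs (sval k); apply: h; apply/eqP.
      * apply/implyP => od; have /and3P[_ _ /implyP h] := fs (sval k).
        by apply: h; clear -e od; lia.
      * have /adjE[_ a1 a2] := H2 k; have /adjE[_ b1 b2] := H3 k.
        move: a1 a2 b1 b2; rewrite PI PJ RI RJ => a1 a2 b1 b2.
        by case: (pre_post_intro a1 b1 a2 b2) => h _; apply: h.
    + move=> k e; have /adjE[_ a1 a2] := H2 k; have /adjE[_ b1 b2] := H3 k.
      move: a1 a2 b1 b2; rewrite PI PJ RI RJ => a1 a2 b1 b2.
      by case: (pre_post_intro a1 b1 a2 b2) => _ h; apply: h.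
    + by clear -nl; lia.
    + by clear -nr; lia.
case=> -[pN p_inj pstep] fc [[left right [_ fcw] before] after nl nr].
apply/andP; split.
  by apply/andP; split; apply/implyP => h; [move: (nl h) | move: (nr h)]; clear; lia.
have ne k : p k <> c := free_neq fc.
have new k : p k <> c + w := free_neq fcw.
apply/generic_pairsP; split=> [k l kl|k|k]; apply/adjE.
- split=> [e||]; [|exact: pstep..].
  by move/eqP: kl; apply; apply: p_inj.
- have [+ _] := pre_post_elim (@ne k) (@new k) (before k) (after k).
  by rewrite PI RI.
- have [_] := pre_post_elim (@ne k) (@new k) (before k) (after k).
  by rewrite PJ RJ.
Qed.

End Config.

(** A block at position 0 or q/2 whose signs are not the chosen ones there is
    not the block of any pair of residues, so it has to be excluded. *)
Hypothesis canonical_left : (~~ oi && si || ~~ oj && sj) ==> noleft.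
Hypothesis canonical_right :
  ~~ odd q && ((oi || ~~ oj) && ~~ si || (oj || ~~ oi) && ~~ sj) ==> noright.

Definition choice_of_config (x : 'rV['Z_q]_m) : 'I_nsep.+1 * {ffun L -> 'I_nsep.+1 * bool} :=
  (inord (seps (letter_pos x) (block_pos x)),
   [ffun k => (inord (seps (letter_pos x) (letter_pos x k)), letter_sgn x k)]).

Lemma block_configs_at x : x \in block_configs ->
  [/\ fold_pos (x ord0 I) = block_pos x + oi,
      fold_pos (x ord0 J) = block_pos x + oj,
      fold_sgn (x ord0 I) = si & fold_sgn (x ord0 J) = sj].
Proof.
have offsets (a b : nat) : a + oj = b + oi -> a = a - oi + oi /\ b = a - oi + oj.
  by move: oij; clear; lia.
rewrite inE => /andP[/and5P[/eqP sI /eqP sJ /eqP /offsets[eI eJ] _ _] _].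
by split.
Qed.

Lemma choice_of_configP x : x \in block_configs ->
  [/\ arranged (letter_rank (letter_sgn x)) N (letter_pos x),
      ~~ occupied (letter_pos x) (block_pos x),
      (choice_of_config x).1 = seps (letter_pos x) (block_pos x) :> nat,
      forall k, ((choice_of_config x).2 k).1
        = seps (letter_pos x) (letter_pos x k) :> nat
    & choice_of_config x \in choices].
Proof.
move=> xC; have [PI PJ sI sJ] := block_configs_at xC.
have [Np fc pc] : [/\ arranged (letter_rank (letter_sgn x)) N (letter_pos x),
    ~~ occupied (letter_pos x) (block_pos x)
  & position_choice (block_pos x) (letter_pos x) (letter_sgn x)].
  by apply/(block_configsP PI PJ sI sJ).
have cN : block_pos x < N.
  by case: pc => -[_ _ [] h _ _ _ _ _]; exact: leq_ltn_trans (leq_addr _ _) h.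
have SE := seps_nsep Np.
have lec : seps (letter_pos x) (block_pos x) <= nsep.
  by rewrite -SE; apply: leq_seps; apply: ltnW.
have lek k : seps (letter_pos x) (letter_pos x k) <= nsep.
  by rewrite -SE; apply: leq_seps; apply: ltnW; case: Np.
split=> // [|k|]; [by rewrite /= inordK | by rewrite /= ffunE inordK //; exact: lek | ].
apply/choicesP; have := (position_choiceP Np fc cN).1 pc.
rewrite inordK ?ltnS //; congr gap_choice; apply: functional_extensionality => k;
  by rewrite ffunE ?inordK ?ltnS.
Qed.

Lemma choice_of_config_inj : {in block_configs &, injective choice_of_config}.
Proof.
have q1 : 1 < q by clear -q4; lia.
move=> x y xC yC e.
have [PIx PJx sIx sJx] := block_configs_at xC.
have [PIy PJy sIy sJy] := block_configs_at yC.
have [Nx fx ex gx _] := choice_of_configP xC.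
have [Ny fy ey gy _] := choice_of_configP yC.
have sgE : letter_sgn x = letter_sgn y.
  apply: functional_extensionality => k.
  pose sign (sf : 'I_nsep.+1 * {ffun L -> 'I_nsep.+1 * bool}) := (sf.2 k).2.
  by move/(congr1 sign): e; rewrite /sign !ffunE.
have pE : letter_pos x = letter_pos y.
  apply: functional_extensionality => k.
  rewrite -(sort_positionK Nx k) -(sort_positionK Ny k) sgE.
  congr (sort_position _ _ k); apply: functional_extensionality => l.
  by rewrite -gx -gy e.
have cE : block_pos x = block_pos y.
  by apply: (seps_inj (p := letter_pos x)) => //; rewrite ?pE // -ey -e ex pE.
apply/rowP => a; apply: eq_fold => //.
  case: (boolP ((a != I) && (a != J))) => [h|].
    exact: (congr1 (fun p => p (exist _ a h)) pE).
  rewrite negb_and !negbK => /orP[]/eqP->; first by rewrite PIx PIy cE.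
  by rewrite PJx PJy cE.
case: (boolP ((a != I) && (a != J))) => [h|].
  exact: (congr1 (fun p => p (exist _ a h)) sgE).
rewrite negb_and !negbK => /orP[]/eqP->; first by rewrite sIx sIy.
by rewrite sJx sJy.
Qed.

Lemma choice_of_config_onto sf : sf \in choices ->
  exists2 x, x \in block_configs & choice_of_config x = sf.
Proof.
have q1 : 1 < q by clear -q4; lia.
case: sf => s f /choicesP gc.
set sg := fun k => (f k).2 in gc; set g := fun k => nat_of_ord (f k).1 in gc.
pose p := sort_position (letter_rank sg) g.
have r_inj := @letter_rank_inj sg.
have Np : arranged (letter_rank sg) N p.
  by rewrite -nsepE; apply: sort_position_arranged => // k; rewrite -ltnS ltn_ord.
have gE k : seps p (p k) = g k by apply: seps_sort_position.
have [c [cN fc cE]] : exists c, [/\ c < N, ~~ occupied p c & seps p c = s].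
  apply: seps_onto; rewrite (seps_nsep Np); case: gc => h _ _ _.
  exact: leq_ltn_trans (leq_addr _ _) h.
have pc : position_choice c p sg.
  apply/(position_choiceP Np fc cN); rewrite cE; move: gc; congr gap_choice.
  by apply: functional_extensionality => k; rewrite gE.
pose x : 'rV['Z_q]_m := (\row_a
  if insub a is Some k then unfold_pos q (p k) (sg k)
  else if a == I then unfold_pos q (c + oi)%N si else unfold_pos q (c + oj)%N sj)%R.
have [[left right [cwN _] _] _ nl nr] := pc.
have xk (k : L) : fold_pos (x ord0 (sval k)) = p k /\ fold_sgn (x ord0 (sval k)) = sg k.
  rewrite mxE valK; apply: unfoldK => //; apply/and3P; split.
  - by rewrite -ltnS; case: Np.
  - by apply/implyP => /eqP /left.
  - apply/implyP => e; have := right k; move: e; clear; lia.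
have xI : fold_pos (x ord0 I) = c + oi /\ fold_sgn (x ord0 I) = si.
  rewrite mxE insubF ?eqxx //; apply: unfoldK => //.
  move: nl nr canonical_left canonical_right cwN oij; rewrite /signed_pos.
  clear; case: oi; case: oj => //=; case: noleft; case: noright; case: si => /=; lia.
have xJ : fold_pos (x ord0 J) = c + oj /\ fold_sgn (x ord0 J) = sj.
  rewrite mxE insubF ?eqxx ?andbF // ifN; last by rewrite -val_eqE /= gtn_eqF.
  apply: unfoldK => //.
  move: nl nr canonical_left canonical_right cwN oij; rewrite /signed_pos.
  clear; case: oi; case: oj => //=; case: noleft; case: noright; case: sj => /=; lia.
have pE : letter_pos x = p.
  by apply: functional_extensionality => k; exact: (xk k).1.
have sgE : letter_sgn x = sg.
  by apply: functional_extensionality => k; exact: (xk k).2.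
exists x.
  apply/(block_configsP xI.1 xJ.1 xI.2 xJ.2).
  have : [/\ arranged (letter_rank (letter_sgn x)) N (letter_pos x),
      ~~ occupied (letter_pos x) c & position_choice c (letter_pos x) (letter_sgn x)].
    by rewrite pE sgE.
  exact.
rewrite /choice_of_config pE sgE /block_pos xI.1 addnK; congr pair.
  by apply: val_inj; rewrite /= inordK cE.
apply/ffunP => k; rewrite ffunE gE /g inord_val.
by rewrite /sg; case: (f k).
Qed.

Lemma card_block_configs : #|block_configs| = #|choices|.
Proof.
rewrite -(card_in_imset choice_of_config_inj); apply: eq_card => sf.
apply/imsetP/idP => [[x xC ->]|/choice_of_config_onto[x xC <-]].
  by have [] := choice_of_configP xC.
by exists x.
Qed.

End Blocks.

(** * Counting the choices of gaps and signs *)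

(** Independent choices multiply. *)
Lemma card_forall_ffun (A B : finType) (P : A -> B -> bool) :
  #|[set f : {ffun A -> B} | [forall k, P k (f k)]]|
  = \prod_k #|[set y | P k y]|.
Proof.
rewrite -sum1dep_card big_mkcond /=.
under [RHS]eq_bigr => k _ do rewrite -sum1dep_card big_mkcond /=.
rewrite bigA_distr_bigA /=; apply: eq_bigr => f _.
case: forallP => [H|nH].
  by rewrite big1 // => k _; rewrite H.
have /existsP[k nk] : [exists k, ~~ P k (f k)].
  by rewrite -negb_forall; apply/negP => /forallP.
by rewrite (bigD1 k) //= (negPf nk) mul0n.
Qed.

Section Counting.

Variables (m q : nat) (I J : 'I_m) (oi si oj sj noleft noright : bool).
Hypotheses (ltIJ : I < J) (oij : ~~ (oi && oj)).

Local Notation w := (oi + oj).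
Local Notation L := (letters I J).
Local Notation nsep := (nsep q I J).
Local Notation pre := (pre I J oi si oj sj).
Local Notation post := (post I J oi si oj sj).
Local Notation fits := (allowed q I J oi si oj sj).
Local Notation choices := (choices q I J oi si oj sj noleft noright).

(** The gaps and signs open to the letter [k].  The flags forbid the first and
    the last gap: a block touches an end of the word exactly when it is the
    outermost separator there and the outermost gap is empty. *)
Definition slots (s k : nat) (zl zr : bool) : {set 'I_nsep.+1 * bool} :=
  [set y : 'I_nsep.+1 * bool | fits s k y.1 y.2 && ~~ (zl && (y.1 == 0 :> nat))
     && ~~ (zr && (y.1 == nsep :> nat))].

(** Each gap away from the block offers two signs, except that the first gap
    offers one, and so does the last one when [q] is even.  The four summands
    are the gaps before the block, the gap just before it, the gap just after
    it, and the gaps after that. *)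
Lemma card_slots s k (zl zr : bool) :
  s + w < nsep -> (zl -> s = 0) -> (zr -> (s + w).+1 = nsep) ->
  #|slots s k zl zr|
  = (s.*2 - (0 < s)) + ~~ zl * ((pre k true && (0 < s)) + pre k false)
    + ~~ zr * (post k true + (post k false && (odd q || ((s + w).+1 != nsep))))
    + ((nsep - (s + w).+1).*2 - (~~ odd q && ((s + w).+1 < nsep))).
Proof.
move=> sS zl0 zrS.
pose a g b : nat := fits s k g b && ~~ (zl && (g == 0)) && ~~ (zr && (g == nsep)).
transitivity (\sum_(0 <= g < nsep.+1) (a g true + a g false)).
  rewrite -sum1dep_card big_mkcond /= big_mkord.
  rewrite (eq_bigr (fun y : 'I_nsep.+1 * bool => a y.1 y.2)); last first.
    by move=> y _; rewrite /a; case: ifP.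
  rewrite -(pair_bigA _ (fun (g : 'I_nsep.+1) b => a g b)) /=.
  by apply: eq_bigr => g _; rewrite big_bool.
have aE g b : a g b = [&& (g == 0) ==> ~~ b, (~~ odd q && (g == nsep)) ==> b,
    (g == s) ==> pre k b, (g == (s + w).+1) ==> post k b,
    (oi || oj) ==> (g != s.+1), ~~ (zl && (g == 0)) & ~~ (zr && (g == nsep))].
  by rewrite /a /allowed -!andbA.
clearbody a.
have zlF g : g < s -> zl = false.
  by move=> gs; apply/negP => /zl0 s0; move: gs; rewrite s0.
have low d : d <= s -> \sum_(0 <= g < d) (a g true + a g false) = d.*2 - (0 < d).
  elim: d => [|d IH] ds; first by rewrite big_geq.
  rewrite big_nat_recr //= (IH (ltnW ds)) !aE (zlF _ ds).
  have [-> -> -> ->] : [/\ (d == s) = false, (d == (s + w).+1) = false,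
      (d == s.+1) = false & (d == nsep) = false].
    by move: sS ds; clear; split; lia.
  by rewrite /= !andbF !implybT /=; clear; case: d => //=; lia.
have high d : d <= nsep - (s + w).+1 ->
    \sum_((s + w).+2 <= g < (s + w).+2 + d) (a g true + a g false)
    = d.*2 - (~~ odd q && (0 < d) && (d == nsep - (s + w).+1)).
  elim: d => [|d IH] ds; first by rewrite big_geq // addn0.
  rewrite addnS big_nat_recr ?leq_addr //= (IH (ltnW ds)).
  have -> : a ((s + w).+2 + d) true + a ((s + w).+2 + d) false
      = 1 + ~~ (~~ odd q && (d.+1 == nsep - (s + w).+1)).
    rewrite !aE.
    have [-> -> -> ->] : [/\ ((s + w).+2 + d == s) = false,
        ((s + w).+2 + d == (s + w).+1) = false,
        ((s + w).+2 + d == s.+1) = false & ((s + w).+2 + d == 0) = false].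
      by clear; split; lia.
    have -> : ((s + w).+2 + d == nsep) = (d.+1 == nsep - (s + w).+1).
      by move: sS ds; clear; lia.
    have -> : zr = false.
      by apply/negP => /zrS e; move: ds; rewrite e subnn.
    by rewrite /= !andbF !implybT /=; case: (odd q) => //=; case: eqP.
  by move: ds; clear; case: (odd q) => /=; lia.
rewrite (@big_cat_nat _ _ _ s) //=; last by lia.
rewrite low // (@big_cat_nat _ _ _ (s + w).+2) /=; [|lia|lia].
have -> : \sum_(s <= g < (s + w).+2) (a g true + a g false)
    = (a s true + a s false) + (a (s + w).+1 true + a (s + w).+1 false).
  have [w0|w1] : w = 0 \/ w = 1 by lia.
    by rewrite w0 addn0 big_ltn // big_nat1.
  rewrite w1 addn1 big_ltn; last by rewrite ltnS leqW.
  rewrite (@big_ltn _ _ _ s.+1) // big_nat1.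
  have -> : a s.+1 true + a s.+1 false = 0.
    have w1' : oi || oj by move: w1; clear; case: (oi); case: (oj).
    by rewrite !aE w1' eqxx /= !andbF.
  by [].
have -> : nsep.+1 = (s + w).+2 + (nsep - (s + w).+1) by move: sS; clear; lia.
rewrite high //.
have sE : [/\ (s == (s + w).+1) = false, (s == s.+1) = false & (s == nsep) = false].
  by move: sS; clear; split; lia.
have tE : [/\ ((s + w).+1 == s) = false, ((s + w).+1 == 0) = false &
   (oi || oj) ==> ((s + w).+1 != s.+1)].
  by clear; split; case: (oi); case: (oj) => //=; lia.
have -> : a s true + a s false = ~~ zl * ((pre k true && (0 < s)) + pre k false).
  rewrite !aE; case: sE => -> -> ->; rewrite eqxx /= !andbF !implybT /= ?andbT.
  move: zl0; clear; case: (zl) => [->//|_] /=.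
    by rewrite /= ?eqxx /= ?andbF.
  rewrite lt0n; case: (pre k true); case: (pre k false); by case: eqP => //=.
have -> : a (s + w).+1 true + a (s + w).+1 false =
   ~~ zr * (post k true + (post k false && (odd q || ((s + w).+1 != nsep)))).
  rewrite !aE; case: tE => -> -> ->; rewrite eqxx /= !andbF /= ?andbT.
  move: zrS; clear; case: (zr) => [->//|_] /=.
    by rewrite /= ?eqxx /= ?andbF.
  by rewrite !andbT; case: (odd q); case: eqP; case: (post k true); case: (post k false).
by move: sS; clear; case: (odd q) => /=; lia.
Qed.


Local Notation pre_count k := (pre (label k) true + pre (label k) false).
Local Notation post_count k := (post (label k) true + post (label k) false).

Lemma card_letters : #|{: L}| = m - 2.
Proof.
rewrite card_sig -[in RHS](card_ord m).
have nJI : (J == I) = false by rewrite -val_eqE /= gtn_eqF.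
rewrite [in RHS](cardD1 I) [in RHS](cardD1 J) !inE nJI /=.
rewrite addnA addKn; apply: eq_card => a; rewrite !inE andbT.
by rewrite andbC.
Qed.

Definition fits_all (s : nat) (zl zr : bool) : {set {ffun L -> 'I_nsep.+1 * bool}} :=
  [set f : {ffun L -> 'I_nsep.+1 * bool} |
    [forall k, f k \in slots s (label k) zl zr]].

Lemma card_fits_all s zl zr :
  #|fits_all s zl zr| = \prod_(k : L) #|slots s (label k) zl zr|.
Proof.
rewrite /fits_all (card_forall_ffun (fun k : L => mem (slots s (label k) zl zr))).
by apply: eq_bigr => k _; apply: eq_card => y; rewrite inE.
Qed.

Lemma fits_allS s zl zr : fits_all s zl zr \subset fits_all s false false.
Proof.
apply/subsetP => f; rewrite !inE => /forallP H; apply/forallP => k.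
by have := H k; rewrite !inE /= !andbT -andbA => /andP[].
Qed.

Definition choices_at (s : nat) : {set {ffun L -> 'I_nsep.+1 * bool}} :=
  fits_all s false false
    :\: (if noleft && (s == 0) then fits_all s true false else set0)
    :\: (if noright && ((s + w).+1 == nsep) then fits_all s false true else set0).

(** A letter configuration is discarded because of an excluded end only as a
    whole, when no letter uses the outermost gap. *)
Lemma choices_atE (s : 'I_nsep.+1) f :
  ((s, f) \in choices) = (s + w < nsep) && (f \in choices_at s).
Proof.
have fitsE : (f \in fits_all s false false)
    = [forall k, fits s (label k) (f k).1 (f k).2].
  by rewrite inE; apply: eq_forallb => k; rewrite inE !andbT.
have fitsL : (f \in fits_all s true false) = (f \in fits_all s false false)
    && [forall k, (f k).1 != 0 :> nat].
  rewrite !inE; apply/forallP/andP => [H|[/forallP H1 /forallP H2] k].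
    by split; apply/forallP => k; have := H k; rewrite !inE /= ?andbT => /andP[].
  by have := H1 k; rewrite !inE /= !andbT H2 andbT.
have fitsR : (f \in fits_all s false true) = (f \in fits_all s false false)
    && [forall k, (f k).1 != nsep :> nat].
  rewrite !inE; apply/forallP/andP => [H|[/forallP H1 /forallP H2] k].
    by split; apply/forallP => k; have := H k; rewrite !inE /= ?andbT => /andP[].
  by have := H1 k; rewrite !inE /= !andbT H2 andbT.
rewrite [LHS]inE /=; congr (_ && _).
rewrite -fitsE /choices_at !in_setD.
rewrite !(fun_if (fun A : {set {ffun L -> 'I_nsep.+1 * bool}} => f \in A)) fitsL fitsR.
rewrite in_set0; case: (f \in fits_all s false false) => /=; last first.
  by rewrite !andbF.
case: noleft; case: noright; case: (s == 0 :> nat); case: ((s + w).+1 == nsep);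
  by rewrite /= ?andbT ?andbF //= andbC.
Qed.

Lemma card_choices : #|choices| = \sum_(0 <= s < nsep - w) #|choices_at s|.
Proof.
have -> : #|choices| = \sum_(s < nsep.+1) \sum_(f | (s, f) \in choices) 1.
  by rewrite -sum1_card pair_big_dep /=; apply: eq_bigl => -[s f].
rewrite (eq_bigr (fun s : 'I_nsep.+1 => (s + w < nsep) * #|choices_at s|)); last first.
  move=> s _; rewrite sum1dep_card.
  case lt: (s + w < nsep); rewrite ?mul1n ?mul0n.
    by apply: eq_card => f; rewrite inE choices_atE lt.
  by apply: eq_card0 => f; rewrite inE choices_atE lt.
rewrite -(big_mkord xpredT (fun s => (s + w < nsep) * #|choices_at s|)).
have le : nsep - w <= nsep.+1 by apply: leq_trans (leq_subr _ _) (leqnSn _).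
rewrite (@big_cat_nat _ _ _ (nsep - w)) //= [X in _ + X]big1_seq ?addn0; last first.
  move=> s; rewrite mem_index_iota => /andP[_ /andP[h _]].
  by have -> : (s + w < nsep) = false; [move: h; clear; lia | rewrite mul0n].
rewrite !big_nat; apply: eq_bigr => s /andP[_ h].
by have -> : s + w < nsep; [move: h; clear; lia | rewrite mul1n].
Qed.

(** The block has [nsep - w] possible places; all but the two outermost ones
    contribute the same product.  The numbers of discarded words are added on
    the left to avoid truncated subtractions. *)
Lemma card_choices_sum D : 1 < m -> m <= q./2 -> 2 < D -> q + 2 = D + w.*2 + m.*2 ->
  #|choices| + noleft * \prod_(k : L) (D.+1 + post_count k)
    + noright * \prod_(k : L) (D + ~~ odd q + pre_count k)
  = \prod_(k : L) (D.+1 + pre (label k) false + post_count k)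
    + (nsep - w - 2) * \prod_(k : L) (D + pre_count k + post_count k)
    + \prod_(k : L) (D + ~~ odd q + pre_count k
                     + (post (label k) true + (odd q && post (label k) false))).
Proof.
move=> m1 mq D2 qE.
have SE : nsep.*2 = D + w.*2 + 3 + ~~ odd q.
  rewrite /nsep card_letters; move: m1 mq qE; clear; lia.
have S3 : w + 2 < nsep by move: SE D2; clear; case: (odd q) => /=; lia.
rewrite card_choices.
have -> : nsep - w = (nsep - w - 2).+2 by move: S3; clear; lia.
rewrite big_nat_recl // big_nat_recr //=.
have at0 : #|choices_at 0| + noleft * \prod_(k : L) (D.+1 + post_count k)
    = \prod_(k : L) (D.+1 + pre (label k) false + post_count k).
  rewrite /choices_at eqxx andbT (_ : (0 + w).+1 == nsep = false); last first.
    by move: S3; clear; lia.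
  rewrite andbF setD0.
  have -> : \prod_(k : L) (D.+1 + pre (label k) false + post_count k)
      = #|fits_all 0 false false|.
    rewrite card_fits_all; apply: eq_bigr => k _; rewrite card_slots //; last first.
      by move: S3; clear; lia.
    rewrite (_ : (0 + w).+1 < nsep); last by move: S3; clear; lia.
    rewrite neq_ltn (_ : (0 + w).+1 < nsep); last by move: S3; clear; lia.
    by rewrite orbT !andbT andbF; move: SE S3; clear; case: (odd q) => /=; lia.
  case: noleft; last by rewrite setD0 mul0n addn0.
  have -> : \prod_(k : L) (D.+1 + post_count k) = #|fits_all 0 true false|.
    rewrite card_fits_all; apply: eq_bigr => k _; rewrite card_slots //; last first.
      by move: S3; clear; lia.
    rewrite (_ : (0 + w).+1 < nsep); last by move: S3; clear; lia.
    rewrite neq_ltn (_ : (0 + w).+1 < nsep); last by move: S3; clear; lia.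
    by rewrite orbT !andbT; move: SE S3; clear; case: (odd q) => /=; lia.
  by rewrite mul1n -(cardsID (fits_all 0 true false) (fits_all 0 false false))
     (setIidPr (fits_allS _ _ _)) addnC.
have at1 : #|choices_at (nsep - w - 2).+1|
      + noright * \prod_(k : L) (D + ~~ odd q + pre_count k)
    = \prod_(k : L) (D + ~~ odd q + pre_count k
                     + (post (label k) true + (odd q && post (label k) false))).
  have lE : ((nsep - w - 2).+1 + w).+1 = nsep by move: S3; clear; lia.
  rewrite /choices_at andbF setD0 lE eqxx andbT.
  have -> : \prod_(k : L) (D + ~~ odd q + pre_count k
       + (post (label k) true + (odd q && post (label k) false)))
      = #|fits_all (nsep - w - 2).+1 false false|.
    rewrite card_fits_all; apply: eq_bigr => k _; rewrite card_slots //; last first.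
      by move: S3; clear; lia.
    rewrite lE eqxx ltnn subnn /= orbF andbT andbF (andbC (post (label k) false)).
    by move: SE S3; clear; case: (odd q) => /=; lia.
  case: noright; last by rewrite setD0 mul0n addn0.
  have -> : \prod_(k : L) (D + ~~ odd q + pre_count k)
      = #|fits_all (nsep - w - 2).+1 false true|.
    rewrite card_fits_all; apply: eq_bigr => k _; rewrite card_slots //; last first.
      by move: S3; clear; lia.
    rewrite lE eqxx ltnn subnn /= andbT andbF.
    by move: SE S3; clear; case: (odd q) => /=; lia.
  by rewrite mul1n -(cardsID (fits_all (nsep - w - 2).+1 false true)
     (fits_all (nsep - w - 2).+1 false false)) (setIidPr (fits_allS _ _ _)) addnC.
rewrite -at0 -at1.
rewrite (@eq_big_nat _ _ _ 0 (nsep - w - 2) (fun s => #|choices_at s.+1|)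
  (fun=> \prod_(k : L) (D + pre_count k + post_count k))); last first.
  move=> s /andP[_ sS].
  rewrite /choices_at andbF setD0 (_ : (s.+1 + w).+1 == nsep = false); last first.
    by move: sS S3; clear; lia.
  rewrite andbF setD0 card_fits_all; apply: eq_bigr => k _; rewrite card_slots //; last first.
    by move: sS S3; clear; lia.
  rewrite (_ : (s.+1 + w).+1 < nsep); last by move: sS S3; clear; lia.
  rewrite neq_ltn (_ : (s.+1 + w).+1 < nsep); last by move: sS S3; clear; lia.
  by rewrite orbT !andbT; move: SE sS S3; clear; case: (odd q) => /=; lia.
rewrite sum_nat_const_nat !subSS !subn0; ring.
Qed.

End Counting.

Section Classes.

Variables (m : nat) (I J : 'I_m).
Hypothesis ltIJ : I < J.

(** The arguments of [F] tell whether the label is below [I] and below [J]. *)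
Definition class_prod (F : bool -> bool -> nat) : nat :=
  F true true ^ I * F false true ^ (J - I.+1) * F false false ^ (m - J.+1).

Lemma prod_classes (F : bool -> bool -> nat) :
  \prod_(k : letters I J) F (label k < I) (label k < J) = class_prod F.
Proof.
pose G k := F (k < I) (k < J).
transitivity (\prod_(k < m | (k != I) && (k != J)) G k).
  rewrite (reindex_omap (fun k : letters I J => sval k) insub) /=; last first.
    by move=> k kP; rewrite insubT.
  apply: eq_big => [[k kP]|//]; rewrite kP /=; apply/esym/eqP.
  by rewrite insubT; congr Some; apply: val_inj.
rewrite big_mkcond /=.
pose H k := if (k != I :> nat) && (k != J :> nat) then G k else 1.
rewrite (eq_bigr (fun k : 'I_m => H k)) // -(big_mkord xpredT H).
have Im : I < m := ltn_ord I; have Jm : J < m := ltn_ord J.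
rewrite (@big_cat_nat _ _ _ I) //=; last by exact: ltnW.
rewrite (@big_cat_nat _ _ _ I.+1 I) //= big_nat1.
rewrite (@big_cat_nat _ _ _ J I.+1) //=; last by exact: ltnW.
rewrite (@big_cat_nat _ _ _ J.+1 J) //= big_nat1.
have HI : H I = 1 by rewrite /H eqxx.
have HJ : H J = 1 by rewrite /H eqxx andbF.
have const a b c : (forall k, a <= k < b -> H k = c) ->
    \prod_(a <= k < b) H k = c ^ (b - a).
  by move=> Hc; rewrite big_nat (eq_bigr (fun=> c)) // -big_nat prod_nat_const_nat.
rewrite HI HJ !mul1n (const _ _ (F true true)); last first.
  by move=> k /andP[_ kI]; rewrite /H /G kI (ltn_trans kI ltIJ) !ltn_eqF // (ltn_trans kI).
rewrite (const _ _ (F false true)); last first.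
  move=> k /andP[Ik kJ]; rewrite /H /G kJ (gtn_eqF Ik) (ltn_eqF kJ) /=.
  by rewrite ltnNge (ltnW Ik).
rewrite (const _ _ (F false false)); last first.
  move=> k /andP[Jk km]; have Ik := ltn_trans ltIJ Jk.
  by rewrite /H /G (gtn_eqF Ik) (gtn_eqF Jk) /= !ltnNge (ltnW Ik) (ltnW Jk).
by rewrite subn0 /class_prod mulnA.
Qed.

End Classes.

(** [pre] and [post] in terms of the class of the label: two signed labels
    compare according to the sign of the one with the smaller label. *)
Definition pre_class (oi si oj sj ltI ltJ b : bool) : bool :=
  (~~ oi ==> if ltI then b else ~~ si) && (~~ oj ==> if ltJ then b else ~~ sj).

Definition post_class (oi si oj sj ltI ltJ b : bool) : bool :=
  (oi || ~~ oj ==> if ltI then ~~ b else si)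
  && (oj || ~~ oi ==> if ltJ then ~~ b else sj).

Lemma rank_lt m k x b s : k < m -> x < m -> k != x ->
  (rank m k b < rank m x s) = (if k < x then b else ~~ s) /\
  (rank m x s < rank m k b) = (if k < x then ~~ b else s).
Proof.
rewrite /rank => km xm; case: (ltngtP k x) => // lt _.
  by case: b; case: s; split; lia.
by case: b; case: s; split; lia.
Qed.

Section ClassCount.

Variables (m q : nat) (I J : 'I_m) (oi si oj sj noleft noright : bool).
Hypotheses (ltIJ : I < J) (oij : ~~ (oi && oj)).

Local Notation w := (oi + oj).

Lemma pre_classE (k : letters I J) b :
  pre I J oi si oj sj (label k) b = pre_class oi si oj sj (label k < I) (label k < J) b.
Proof.
have /andP[kI kJ] := valP k; rewrite /pre /pre_class.
rewrite (rank_lt b si (label_lt k) (ltn_ord I) _).1 //.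
by rewrite (rank_lt b sj (label_lt k) (ltn_ord J) _).1.
Qed.

Lemma post_classE (k : letters I J) b :
  post I J oi si oj sj (label k) b = post_class oi si oj sj (label k < I) (label k < J) b.
Proof.
have /andP[kI kJ] := valP k; rewrite /post /post_class.
rewrite (rank_lt b si (label_lt k) (ltn_ord I) _).2 //.
by rewrite (rank_lt b sj (label_lt k) (ltn_ord J) _).2.
Qed.

Hypothesis canonical_left : (~~ oi && si || ~~ oj && sj) ==> noleft.
Hypothesis canonical_right :
  ~~ odd q && ((oi || ~~ oj) && ~~ si || (oj || ~~ oi) && ~~ sj) ==> noright.

Local Notation pc := (pre_class oi si oj sj).
Local Notation qc := (post_class oi si oj sj).

(** Here [D] is q - 2m + 2 - 2w, and [n] is the number of places of the block
    other than the two outermost ones. *)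
Lemma card_block_configsE D n : 2 < D -> 1 < m ->
  q + 2 = D + w.*2 + m.*2 -> n.*2.+1 = D + ~~ odd q ->
  #|block_configs q I J oi si oj sj noleft noright|
    + noleft * class_prod I J (fun x y => D.+1 + (qc x y true + qc x y false))
    + noright * class_prod I J (fun x y => D + ~~ odd q + (pc x y true + pc x y false))
  = class_prod I J (fun x y => D.+1 + pc x y false + (qc x y true + qc x y false))
    + n * class_prod I J
        (fun x y => D + (pc x y true + pc x y false) + (qc x y true + qc x y false))
    + class_prod I J (fun x y => D + ~~ odd q + (pc x y true + pc x y false)
        + (qc x y true + (odd q && qc x y false))).
Proof.
move=> D2 m1 qE nE.
have mq : m <= q./2 by move: D2 qE; clear; lia.
have q4 : 3 < q by move: D2 qE m1; clear; lia.
rewrite (card_block_configs ltIJ oij q4 mq canonical_left canonical_right).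
have := card_choices_sum si sj noleft noright ltIJ oij m1 mq D2 qE.
have -> : nsep q I J - w - 2 = n.
  rewrite /nsep (card_letters ltIJ); move: m1 mq qE nE; clear; lia.
move=> e; rewrite -!(prod_classes ltIJ); apply: etrans (etrans e _).
  by congr (_ + _ * _ + _ * _); apply: eq_bigr => k _;
    rewrite ?pre_classE ?post_classE.
by congr (_ + _ * _ + _); apply: eq_bigr => k _; rewrite ?pre_classE ?post_classE.
Qed.

End ClassCount.

(** * The hyperplanes of the arrangement *)

Local Open Scope ring_scope.

(** The four hyperplanes of a pair of coordinates: [e.1] selects the sum or the
    difference, and [e.2] is the right-hand side. *)
Definition shi_hyp (m i j : nat) (e : bool * bool) : hyperplane m :=
  (if e.1 then unit_row m i + unit_row m j else unit_row m i - unit_row m j,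
   (nat_of_bool e.2)%:Z).

Definition shi_eq (q : nat) (u v : 'Z_q) (e : bool * bool) : bool :=
  (if e.1 then u + v else u - v) == (nat_of_bool e.2)%:R.

Lemma generic_pair_shi_eq q (u v : 'Z_q) :
  generic_pair u v = [forall e, ~~ shi_eq u v e].
Proof.
apply/and4P/forallP => [[h1 h2 h3 h4] [[] []] //|H].
by split; [exact: (H (false, false)) | exact: (H (false, true))
  | exact: (H (true, false)) | exact: (H (true, true))].
Qed.

Lemma mem_shiD m K :
  reflect (exists a b : 'I_m, exists2 e, (a < b)%N & K = shi_hyp m a.+1 b.+1 e)
    (K \in (shiD m : seq ('rV[int]_m * int))).
Proof.
apply: (iffP flattenP) => [[s /allpairsPdep[a [b [ha hb ->]]] Ks]|[a [b [e ab ->]]]].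
  move: ha hb; rewrite !mem_index_iota => /andP[a0 am] /andP[ab bm].
  case: a a0 am ab Ks => // a _ am ab; case: b ab bm => // b ab bm Ks.
  exists (Ordinal (am : (a < m)%N)), (Ordinal (bm : (b < m)%N)).
  move: Ks; rewrite !inE => /or4P[] /eqP->.
  - by exists (false, false).
  - by exists (false, true).
  - by exists (true, false).
  - by exists (true, true).
eexists.
  apply/allpairsPdep; exists a.+1, b.+1; split; last by reflexivity.
    by rewrite mem_index_iota /= ltnS.
  by rewrite mem_index_iota ltnS ab /= ltnS.
by rewrite !inE; case: e => [[] []] /=; rewrite ?eqxx ?orbT.
Qed.

Lemma shi_hyp_row m (a b : 'I_m) e k :
  (shi_hyp m a.+1 b.+1 e).1 0 k
  = (k == a)%:R + (if e.1 then 1 else -1) * (k == b)%:R.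
Proof.
by rewrite /shi_hyp /=; case: e.1; rewrite !mxE !eqSS ?mul1r ?mulN1r.
Qed.

(** The equations are pairwise distinct, so that removing one hyperplane from
    the union removes none of the others. *)
Lemma shi_hyp_inj m (a b a' b' : 'I_m) e e' : (a < b)%N -> (a' < b')%N ->
  shi_hyp m a.+1 b.+1 e = shi_hyp m a'.+1 b'.+1 e' -> [/\ a = a', b = b' & e = e'].
Proof.
move=> ab ab' E.
have rowE k := etrans (esym (shi_hyp_row a b e k))
  (etrans (congr1 (fun H : hyperplane m => H.1 0 k) E) (shi_hyp_row a' b' e' k)).
have nab : (a == b) = false by rewrite -val_eqE /= ltn_eqF.
have nba : (b == a) = false by rewrite eq_sym.
have nab' : (a' == b') = false by rewrite -val_eqE /= ltn_eqF.
have aa : a = a'.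
  apply/eqP; apply: contraT => naa.
  have := rowE a; rewrite eqxx nab (negPf naa) mulr0 addr0 add0r => ra.
  have := rowE a'; rewrite eqxx nab' eq_sym (negPf naa) mulr0 addr0 add0r => ra'.
  (* Otherwise the two pairs would be exchanged, against their order. *)
  have eab : a = b'.
    by apply/eqP; move: ra; case: eqP => // _; rewrite mulr0 => /eqP;
      rewrite ?(eq_sym 0) oner_eq0.
  have eba : a' = b.
    by apply/eqP; move: ra'; case: eqP => // _; rewrite mulr0 => /eqP;
      rewrite ?(eq_sym 0) oner_eq0.
  by move: ab ab'; rewrite eab eba => h1 h2; have := ltn_trans h1 h2; rewrite ltnn.
subst a'; have := rowE b; rewrite eqxx nba !add0r mulr1 => rb.
have bb : b = b'.
  by apply/eqP; move: rb; case: eqP => // _; rewrite mulr0; case: e.1 => /eqP;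
    rewrite ?oppr_eq0 oner_eq0.
subst b'; split=> //; move: rb; rewrite eqxx mulr1.
case: E => _; case: e e' {rowE} => [s c] [s' c'] /=.
by case: s; case: s'; case: c; case: c'.
Qed.

Lemma mem_shi_hyp m q (a b : 'I_m) e (x : 'rV['Z_q]_m) :
  (x \in hyperplane_mod q (shi_hyp m a.+1 b.+1 e)) = shi_eq (x 0 a) (x 0 b) e.
Proof.
rewrite inE /shi_eq; congr (_ == _).
under eq_bigr => k _ do rewrite shi_hyp_row.
rewrite (eq_bigr (fun k => (k == a)%:R * x 0 k
   + (if e.1 then 1 else -1) * ((k == b)%:R * x 0 k))); last first.
  move=> k _; rewrite rmorphD rmorphM /= mulrDl mulrA !rmorph_nat.
  by case: e.1; rewrite ?rmorphN rmorph1.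
rewrite big_split -mulr_sumr /=.
have pick (c : 'I_m) : \sum_k (k == c)%:R * x 0 k = x 0 c.
  rewrite (bigD1 c) //= eqxx mul1r big1 ?addr0 // => k /negPf->.
  by rewrite mul0r.
by rewrite !pick; case: e.1; rewrite ?mul1r ?mulN1r.
Qed.

Lemma mem_bigcup_seq (A : Type) (B : finType) (r : seq A) (P : pred A)
    (F : A -> {set B}) y :
  (y \in \bigcup_(K <- r | P K) F K) = has (fun K => P K && (y \in F K)) r.
Proof.
elim: r => [|K r IH]; first by rewrite big_nil inE.
by rewrite big_cons /=; case: (P K); rewrite // inE IH.
Qed.

Lemma restr_compl_shiD m q (I J : 'I_m) e (x : 'rV['Z_q]_m) : (I < J)%N ->
  x \in restr_compl_mod q (shiD m) (shi_hyp m I.+1 J.+1 e)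
  = [forall e', shi_eq (x 0 I) (x 0 J) e' == (e' == e)] &&
    [forall a : 'I_m, forall b : 'I_m, ((a < b)%N && ((a, b) != (I, J))) ==>
      generic_pair (x 0 a) (x 0 b)].
Proof.
move=> ltIJ; rewrite inE mem_shi_hyp.
apply/andP/andP => [[nK xH]|[/forallP xIJ /forallP xab]].
  have K (a b : 'I_m) e' : (a < b)%N -> ((a, b), e') != ((I, J), e) ->
      ~~ shi_eq (x 0 a) (x 0 b) e'.
    move=> ab ne; apply: contra nK; rewrite -mem_shi_hyp => xK.
    rewrite mem_bigcup_seq; apply/hasP; exists (shi_hyp m a.+1 b.+1 e').
      by apply/mem_shiD; exists a, b, e'.
    rewrite xK andbT; apply: contraNneq ne => /(shi_hyp_inj ab ltIJ)[-> -> ->].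
    by [].
  split.
    apply/forallP => e'; have [->|ne] := eqVneq e' e; first by rewrite xH.
    by rewrite (negPf (K _ _ _ ltIJ _)) // xpair_eqE (negPf ne) andbF.
  apply/forallP => a; apply/forallP => b; apply/implyP => /andP[ab ne].
  rewrite generic_pair_shi_eq; apply/forallP => e'.
  by apply: K => //; rewrite xpair_eqE (negPf ne).
split; last by have /eqP-> := xIJ e; rewrite eqxx.
rewrite mem_bigcup_seq; apply/hasPn => K /mem_shiD[a [b [e' ab ->]]].
rewrite negb_and negbK orbC mem_shi_hyp -implybE; apply/implyP => xK.
apply/eqP.
have [[eI eJ]|ne] := eqVneq (a, b) (I, J).
  subst a b; have /eqP := xIJ e'.
  by rewrite xK => /esym/eqP->.
have /forallP/(_ b)/implyP := xab a; rewrite ab ne generic_pair_shi_eq.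
by move=> /(_ isT)/forallP/(_ e'); rewrite xK.
Qed.

Definition pair_only q (u v : 'Z_q) (e : bool * bool) : bool :=
  [forall e', shi_eq u v e' == (e' == e)].

Lemma pair_onlyE q (u v : 'Z_q) e : pair_only u v e =
  [&& shi_eq u v (false, false) == ((false, false) == e),
      shi_eq u v (false, true) == ((false, true) == e),
      shi_eq u v (true, false) == ((true, false) == e)
    & shi_eq u v (true, true) == ((true, true) == e)].
Proof.
apply/forallP/and4P => [H|[h1 h2 h3 h4] [[] []] //]; by split; exact: H.
Qed.

(** x_i = x_j: a block of width 0 with equal signs.  The equations x_i + x_j = 0
    and x_i + x_j = 1 exclude 0, q/2 and (q + 1)/2, the last one being position
    (q - 1)/2 with sign minus. *)
Lemma pair_only_sub0 q (u v : 'Z_q) : (3 < q)%N ->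
  pair_only u v (false, false) =
  block_at false true false true true (~~ odd q) u v
  || block_at false false false false true true u v.
Proof.
move=> q4; have q1 : (1 < q)%N by lia.
have uq := val_Zq u q1; have vq := val_Zq v q1.
rewrite pair_onlyE /shi_eq /=; case: (Zq_eqs u v q1) => -> -> -> ->.
rewrite /block_at /fold_pos /fold_sgn !xpair_eqE /= ?addn0 ?addn1; lia.
Qed.

(** x_i = x_j + 1: two neighbouring positions with equal signs, x_i being the
    farther one from 0 when the sign is plus. *)
Lemma pair_only_sub1 q (u v : 'Z_q) : (3 < q)%N ->
  pair_only u v (false, true) =
  block_at true true false true true false u v
  || block_at false false true false false (~~ odd q) u v.
Proof.
move=> q4; have q1 : (1 < q)%N by lia.
have uq := val_Zq u q1; have vq := val_Zq v q1.
rewrite pair_onlyE /shi_eq /=; case: (Zq_eqs u v q1) => -> -> -> ->.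
rewrite /block_at /fold_pos /fold_sgn !xpair_eqE /= ?addn0 ?addn1; lia.
Qed.

(** x_i = - x_j: a block of width 0 with opposite signs. *)
Lemma pair_only_add0 q (u v : 'Z_q) : (3 < q)%N ->
  pair_only u v (true, false) =
  block_at false true false false true (~~ odd q) u v
  || block_at false false false true true true u v.
Proof.
move=> q4; have q1 : (1 < q)%N by lia.
have uq := val_Zq u q1; have vq := val_Zq v q1.
rewrite pair_onlyE /shi_eq /=; case: (Zq_eqs u v q1) => -> -> -> ->.
rewrite /block_at /fold_pos /fold_sgn !xpair_eqE /= ?addn0 ?addn1; lia.
Qed.

(** x_i = 1 - x_j: two neighbouring positions with opposite signs. *)
Lemma pair_only_add1 q (u v : 'Z_q) : (3 < q)%N ->
  pair_only u v (true, true) =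
  block_at true true false false true false u v
  || block_at false false true true false (~~ odd q) u v.
Proof.
move=> q4; have q1 : (1 < q)%N by lia.
have uq := val_Zq u q1; have vq := val_Zq v q1.
rewrite pair_onlyE /shi_eq /=; case: (Zq_eqs u v q1) => -> -> -> ->.
rewrite /block_at /fold_pos /fold_sgn !xpair_eqE /= ?addn0 ?addn1; lia.
Qed.

(** * The four restrictions *)

Lemma natr_succ (t : nat) :
  ((t.+1.+4%:R = t%:R + 5 :> rat)%R * (t.+4%:R = t%:R + 4 :> rat)%R
   * (t.+3%:R = t%:R + 3 :> rat)%R * (t.+2%:R = t%:R + 2 :> rat)%R
   * (t.+1%:R = t%:R + 1 :> rat)%R)%type.
Proof. by do !split; rewrite ?natr1 -?natrD ?addnS ?addn0. Qed.

(** Evaluates two instances of [card_block_configsE] and adds them up.  The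
    powers are generalized, so that what remains is linear in the two unknown
    cardinals once q - 2m is expressed by the number of inner places. *)
Ltac solve_counts t I J m :=
  rewrite /class_prod /pre_class /post_class /=
    ?(addn0, add0n, addn1, add1n, addnS, addSn, mul0n, mul1n);
  let nE := fresh in let E1 := fresh in let E2 := fresh in
  move=> /(congr1 (fun k => k%:R : rat)) nE
    /(congr1 (fun k => k%:R : rat)) E1 /(congr1 (fun k => k%:R : rat)) E2;
  move: nE E1 E2; rewrite -?muln2 -?[(_ * 2).+1]addn1 ?(natrD, natrM, natrX);
  rewrite ?(natr_succ t) ?(exprS, exprD);
  repeat match goal with
  | |- context [?x ^+ nat_of_ord I] => move: (x ^+ nat_of_ord I) => ?
  | |- context [?x ^+ (nat_of_ord J - (nat_of_ord I).+1)] =>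
      move: (x ^+ (nat_of_ord J - (nat_of_ord I).+1)) => ?
  | |- context [?x ^+ (m - (nat_of_ord J).+1)] =>
      move: (x ^+ (m - (nat_of_ord J).+1)) => ?
  end;
  let TE := fresh in
  match goal with
  | |- _ = _ + ?k -> _ =>
      move=> /(congr1 (fun z => z - k)); move=> TE; rewrite [RHS]addrK in TE; rewrite -TE
  | _ => move=> <-
  end; lra.

Section Assembly.

Variables (m q : nat) (I J : 'I_m).
Hypothesis ltIJ : (I < J)%N.

(** The two families of configurations are disjoint, because the sign of the
    coordinate [I] differs. *)
Lemma card_restr_two_blocks e oi sj nl nr oi' oj oj' sj' nl' nr' :
  (forall u v : 'Z_q, pair_only u v e =
     block_at oi true oj sj nl nr u v || block_at oi' false oj' sj' nl' nr' u v) ->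
  #|restr_compl_mod q (shiD m) (shi_hyp m I.+1 J.+1 e)|
  = (#|block_configs q I J oi true oj sj nl nr|
    + #|block_configs q I J oi' false oj' sj' nl' nr'|)%N.
Proof.
move=> pE; rewrite -cardUI.
have -> : #|[predI block_configs q I J oi true oj sj nl nr
    & block_configs q I J oi' false oj' sj' nl' nr']| = 0%N.
  apply: eq_card0 => x; rewrite !inE /block_at.
  by case: (fold_sgn (x 0 I)); rewrite /= ?andbF.
rewrite addn0; apply: eq_card => x.
by rewrite restr_compl_shiD // -/(pair_only _ _ _) pE !inE andb_orl.
Qed.

Variable t : nat.
Hypotheses (t3 : (2 < t)%N) (qE : q = (t + m.*2)%N).

Local Notation T := (t%:R : rat).
Local Notation a := (nat_of_ord I).
Local Notation b := (J - I.+1)%N.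
Local Notation c := (m - J.+1)%N.

Let m1 : (1 < m)%N. Proof. by have := ltn_ord J; move: ltIJ; clear; lia. Qed.
Let q4 : (3 < q)%N. Proof. by move: t3 qE m1; clear; lia. Qed.
Let oddqt : odd q = odd t. Proof. by rewrite qE oddD odd_double addbF. Qed.

Let even_right (x : bool) : ~~ odd q && x ==> ~~ odd q.
Proof. by case: (odd q); case: x. Qed.

Let implb_true (x : bool) : x ==> true. Proof. by case: x. Qed.

Let and_false (x : bool) : x && false ==> false. Proof. by case: x. Qed.

Let D0 : (2 < t.+2)%N. Proof. by move: t3; clear; lia. Qed.

Let qD0 : (q + 2 = t.+2 + (false + false).*2 + m.*2)%N.
Proof. by move: qE; clear; lia. Qed.

Let nE0 : (((t + ~~ odd q).+1)./2.*2.+1 = t.+2 + ~~ odd q)%N.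
Proof. by rewrite oddqt; clear; lia. Qed.

Let qD1 : (q + 2 = t + (true + false).*2 + m.*2)%N.
Proof. by move: qE; clear; lia. Qed.

Let nE1 : (((t + ~~ odd q).-1)./2.*2.+1 = t + ~~ odd q)%N.
Proof. by rewrite oddqt; move: t3; clear; lia. Qed.

Lemma card_restr_sub0 :
  #|restr_compl_mod q (shiD m) (shi_hyp m I.+1 J.+1 (false, false))|%:R =
    (if odd q then
       (T + 3) ^+ b * (T + 4) ^+ c * ((T + 4) ^+ a.+1 - (T + 3) ^+ a)
       - (T + 3) ^+ (b + c) * (T + 4) ^+ a
     else
       (T + 3) ^+ b * (T + 4) ^+ a * ((T + 4) ^+ c.+1 - (T + 3) ^+ c)
       - (T + 3) ^+ (b + c) * (T + 4) ^+ a).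
Proof.
rewrite (card_restr_two_blocks (fun u v => pair_only_sub0 u v q4)).
have := card_block_configsE (oi := false) (si := true) (oj := false) (sj := true)
  (noleft := true) (noright := ~~ odd q) ltIJ isT isT (even_right _) D0 m1 qD0 nE0.
have := card_block_configsE (oi := false) (si := false) (oj := false) (sj := false)
  (noleft := true) (noright := true) ltIJ isT isT (implb_true _) D0 m1 qD0 nE0.
move: nE0; set n := (_./2); move: n => n.
by case: (odd q); solve_counts t I J m.
Qed.

Lemma card_restr_sub1 :
  #|restr_compl_mod q (shiD m) (shi_hyp m I.+1 J.+1 (false, true))|%:R =
    (T + 2) ^+ (a + c).+1 * (T + 3) ^+ b.
Proof.
rewrite (card_restr_two_blocks (fun u v => pair_only_sub1 u v q4)).
have := card_block_configsE (oi := true) (si := true) (oj := false) (sj := true)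
  (noleft := true) (noright := false) ltIJ isT isT (and_false _) t3 m1 qD1 nE1.
have := card_block_configsE (oi := false) (si := false) (oj := true) (sj := false)
  (noleft := false) (noright := ~~ odd q) ltIJ isT isT (even_right _) t3 m1 qD1 nE1.
move: nE1; set n := (_./2); move: n => n.
by case: (odd q); solve_counts t I J m.
Qed.

Lemma card_restr_add0 :
  #|restr_compl_mod q (shiD m) (shi_hyp m I.+1 J.+1 (true, false))|%:R =
    (if odd q then
       (T + 2) ^+ c * (T + 3) ^+ b * ((T + 3) * (T + 4) ^+ a - (T + 3) ^+ a)
     else (T + 2) ^+ c.+1 * (T + 3) ^+ b * (T + 4) ^+ a).
Proof.
rewrite (card_restr_two_blocks (fun u v => pair_only_add0 u v q4)).
have := card_block_configsE (oi := false) (si := true) (oj := false) (sj := false)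
  (noleft := true) (noright := ~~ odd q) ltIJ isT isT (even_right _) D0 m1 qD0 nE0.
have := card_block_configsE (oi := false) (si := false) (oj := false) (sj := true)
  (noleft := true) (noright := true) ltIJ isT isT (implb_true _) D0 m1 qD0 nE0.
move: nE0; set n := (_./2); move: n => n.
by case: (odd q); solve_counts t I J m.
Qed.

Lemma card_restr_add1 :
  #|restr_compl_mod q (shiD m) (shi_hyp m I.+1 J.+1 (true, true))|%:R =
    (if odd q then
       (T + 2) ^+ a * (T + 3) ^+ b.+1 * (T + 4) ^+ c
       - (T + 2) ^+ a * (T + 3) ^+ (b + c)
     else
       (T + 2) ^+ a * (T + 3) ^+ b * ((T + 4) ^+ c.+1 - (T + 3) ^+ c)
       - (T + 2) ^+ a * (T + 3) ^+ (b + c)).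
Proof.
rewrite (card_restr_two_blocks (fun u v => pair_only_add1 u v q4)).
have := card_block_configsE (oi := true) (si := true) (oj := false) (sj := false)
  (noleft := true) (noright := false) ltIJ isT isT (and_false _) t3 m1 qD1 nE1.
have := card_block_configsE (oi := false) (si := false) (oj := true) (sj := true)
  (noleft := false) (noright := ~~ odd q) ltIJ isT isT (even_right _) t3 m1 qD1 nE1.
move: nE1; set n := (_./2); move: n => n.
by case: (odd q); solve_counts t I J m.
Qed.

End Assembly.

Theorem theorem1p7 (m i j : nat) (hm : (0 < m)%N)
    (hi : (1 <= i)%N) (hij : (i < j)%N) (hj : (j <= m)%N) :
  exists q0 : nat, (1 < q0)%N /\
  forall q : nat, (q0 <= q)%N ->
  let T : rat := q%:R - 2 * m%:R in
  [/\ #|restr_compl_mod q (shiD m) (hyp_sub m i j 0)|%:R =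
        (if odd q then
           (T + 3) ^+ (j - i - 1) * (T + 4) ^+ (m - j)
             * ((T + 4) ^+ i - (T + 3) ^+ (i - 1))
           - (T + 3) ^+ (m - i - 1) * (T + 4) ^+ (i - 1)
         else
           (T + 3) ^+ (j - i - 1) * (T + 4) ^+ (i - 1)
             * ((T + 4) ^+ (m - j + 1) - (T + 3) ^+ (m - j))
           - (T + 3) ^+ (m - i - 1) * (T + 4) ^+ (i - 1)),
      #|restr_compl_mod q (shiD m) (hyp_sub m i j 1)|%:R =
        (T + 2) ^+ (m + i - j) * (T + 3) ^+ (j - i - 1),
      #|restr_compl_mod q (shiD m) (hyp_add m i j 0)|%:R =
        (if odd q then
           (T + 2) ^+ (m - j) * (T + 3) ^+ (j - i)
             * ((T + 4) ^+ (i - 1) - (T + 3) ^ (i%:Z - 2))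
         else
           (T + 2) ^+ (m - j + 1) * (T + 3) ^+ (j - i - 1)
             * (T + 4) ^+ (i - 1))
    & #|restr_compl_mod q (shiD m) (hyp_add m i j 1)|%:R =
        (if odd q then
           (T + 2) ^+ (i - 1) * (T + 3) ^+ (j - i) * (T + 4) ^+ (m - j)
           - (T + 2) ^+ (i - 1) * (T + 3) ^+ (m - i - 1)
         else
           (T + 2) ^+ (i - 1) * (T + 3) ^+ (j - i - 1)
             * ((T + 4) ^+ (m - j + 1) - (T + 3) ^+ (m - j))
           - (T + 2) ^+ (i - 1) * (T + 3) ^+ (m - i - 1))].
Proof.
exists (m.*2 + 10)%N; split; first by lia.
move=> q q0 T; case: i hi hij hj => // i' _ hij hj; case: j hij hj => // j' hij hj.
have Im : (i' < m)%N by apply: leq_trans (ltnW hij) hj.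
pose I := Ordinal Im; pose J := Ordinal (hj : (j' < m)%N).
have ltIJ : (I < J)%N by [].
pose t := (q - m.*2)%N.
have t3 : (2 < t)%N by rewrite /t; lia.
have qE : q = (t + m.*2)%N by rewrite /t; lia.
have TE : T = t%:R by rewrite /T [in LHS]qE natrD -muln2 natrM; ring.
have := card_restr_sub0 ltIJ t3 qE; have := card_restr_sub1 ltIJ t3 qE.
have := card_restr_add0 ltIJ t3 qE; have := card_restr_add1 ltIJ t3 qE.
rewrite -TE /= => add1 add0 sub1 sub0.
have e1 : (j'.+1 - i'.+1 - 1 = j' - i'.+1)%N by lia.
have e2 : (m - i'.+1 - 1 = (j' - i'.+1) + (m - j'.+1))%N by lia.
have e3 : (m + i'.+1 - j'.+1 = (i' + (m - j'.+1)).+1)%N by lia.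
have e4 : (j'.+1 - i'.+1 = (j' - i'.+1).+1)%N by lia.
(* The negative exponent for i = 1 is absorbed by one factor T + 3. *)
have T3 : T + 3 != 0.
  by rewrite TE -natrD pnatr_eq0 addn3.
have e5 : (T + 3) * (T + 3) ^ (i'.+1%:Z - 2) = (T + 3) ^+ i'.
  by rewrite -{1}[T + 3]expr1z -expfzDr // (_ : 1 + _ = i'%:Z) //; lia.
rewrite e1 e2 e3 e4 !subn1 addn1 /=; split=> //.
rewrite [LHS]add0; case: (odd q) => //.
by rewrite exprSr -e5; ring.
Qed.
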